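(* Let $n \in \mathbb{N}$, and let $a=(a_j)_{j\ge 0}$ and $c=(c_j)_{j \ge 0}$ be $(n+1)$-periodic infinite sequences of real numbers, with period words $a_0a_1a_2\cdots a_n$ and $c_0c_1c_2\cdots c_n$, respectively. Suppose that \[ c_0=a_1, \qquad |c_1+a_2|=|c_n+a_0|, \qquad |c_1-a_2|=|c_n-a_0|, \] and that \[ |c_j+a_{j+1}|=|c_{n-j+1}+a_{n-j+2}| \quad\text{and}\quad |c_j-a_{j+1}|=|c_{n-j+1}-a_{n-j+2}| \] for all $j=2,3,\dots,\left[\frac n2\right]$. Let $T(a,0,c)$ be the $(n+1)$-periodic tridiagonal operator on $\ell^2(\mathbb{N}_0)$ with zero main diagonal, subdiagonal $a$ and superdiagonal $c$. Then \[ \overline{W(T(a,0,c))}=\mathrm{conv}\left(W(A^+)\cup W(A^-)\right), \] where $A^{+}$ and $A^-$ are the $(n+1)\times(n+1)$ tridiagonal matrices \[ A^{\pm}=\begin{pmatrix} \pm a_1 & c_1 & 0 & \cdots & 0 & 0 & 0\\ a_2 & 0 & c_2 & \cdots & 0 & 0 & 0\\ 0 & a_3 & 0 & \cdots & 0 & 0 & 0\\ \vdots & \vdots & \vdots & \ddots & \vdots & \vdots & \vdots\\ 0 & 0 & 0 & \cdots & 0 & c_{n-1} & 0\\ 0 & 0 & 0 & \cdots & a_n & 0 & c_n\\ 0 & 0 & 0 & \cdots & 0 & a_0 & \pm c_0 \end{pmatrix}. \] That is, with rows and columns indexed by $1,\dots,n+1$: the $(1,1)$ entry is $\pm a_1$,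 the $(n+1,n+1)$ entry is $\pm c_0$ (same sign), all other diagonal entries are $0$; the $(j,j+1)$ entry is $c_j$ and the $(j+1,j)$ entry is $a_{j+1}$ for $1\le j\le n$ (where $a_{n+1}=a_0$); all other entries are $0$.
   Context: $\mathbb{N}$ is the set of positive integers and $\mathbb{N}_0$ the set of nonnegative integers. A sequence $a$ is $(n+1)$-periodic if $a_{k+n+1}=a_k$ for all $k$; its period word is $a_0a_1\cdots a_n$. For $(n+1)$-periodic sequences $a,b,c$ indexed by $\mathbb{N}_0$, $T(a,b,c)$ is the bounded operator on $\ell^2(\mathbb{N}_0)$ whose matrix (rows and columns indexed by $\mathbb{N}_0$) has $(j,j)$ entry $b_j$, $(j,j+1)$ entry $c_j$, $(j+1,j)$ entry $a_{j+1}$ for all $j\ge 0$, and all other entries $0$. In $T(a,0,c)$ the diagonal sequence $b$ is identically zero. For a bounded operator $A$ on a Hilbert space, $W(A)=\{\langle Ax,x\rangle : \|x\|=1\}\subset\mathbb{C}$ is its numerical range; $n\times n$ matrices act on $\mathbb{C}^n$ with the standard inner product. $\mathrm{conv}$ denotes convex hull in $\mathbb{C}$, the bar denotes closure, and $[\cdot]$ denotes the integer part. *)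

(* Defs.v *)
From mathcomp Require Export all_boot all_order all_algebra complex.
From mathcomp Require Export all_classical all_reals all_analysis.

Set Implicit Arguments.
Unset Strict Implicit.
Unset Printing Implicit Defensive.

Import Order.TTheory GRing.Theory Num.Theory.
Export numFieldNormedType.Exports.

Local Open Scope classical_set_scope.
Local Open Scope ring_scope.

(* The Hilbert space is given by its vectors D, a subset of an ambient type V,
   and its inner product, linear in the first argument; the values of A outside
   D are irrelevant. *)
Definition numerical_range (C : numClosedFieldType) (V : Type) (D : set V)
    (dot : V -> V -> C) (A : V -> V) : set C :=
  [set dot (A x) x | x in [set x | D x /\ sqrtC (dot x x) = 1]].

Definition ell2 (C : numClosedFieldType) : set (nat -> C) :=
  [set x : nat -> C | cvgn (series (fun k => `|x k| ^+ 2) : nat -> C)].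

(* The series converges whenever x and y are both in ell2. *)
Definition ell2_dot (C : numClosedFieldType) (x y : nat -> C) : C :=
  limn (series (fun k => x k * (y k)^*) : nat -> C).

Definition op_numerical_range (C : numClosedFieldType)
    (A : (nat -> C) -> (nat -> C)) : set C :=
  numerical_range (@ell2 C) (@ell2_dot C) A.

Definition cdot (C : numClosedFieldType) (n : nat) (x y : 'cV[C]_n) : C :=
  \sum_(i < n) x i 0 * (y i 0)^*.

Definition mx_numerical_range (C : numClosedFieldType) (n : nat)
    (A : 'M[C]_n) : set C :=
  numerical_range setT (@cdot C n) (mulmx A).

(* The weights of convex_set over C range over the t with 0 <= t <= 1 in the
   partial order of C; such t are real, so this is convexity in the real plane. *)
Definition convex_hull (C : numClosedFieldType) (S : set C) : set C :=
  smallest (@convex_set C C^o) S.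

Definition periodic (T : Type) (p : nat) (u : nat -> T) : Prop :=
  forall k, u (k + p)%N = u k.

Definition tridiag_entry (C : numClosedFieldType) (a b c : nat -> C)
    (j k : nat) : C :=
  if k == j then b j
  else if k == j.+1 then c j
  else if j == k.+1 then a j
  else 0.

(* Row j of the matrix vanishes beyond column j + 1, so the sum is finite. *)
Definition tridiag_op (C : numClosedFieldType) (a b c : nat -> C)
    (x : nat -> C) : nat -> C :=
  fun j => \sum_(k < j.+2) tridiag_entry a b c j k * x k.

(* A^+ for e = 1 and A^- for e = -1.  Rows and columns are numbered from 0 here,
   so the 1-based entries (j, j+1) = c_j and (j+1, j) = a_{j+1} are shifted; the
   bottom subdiagonal entry is a n.+1, equal to a 0 by periodicity. *)
Definition Amx (C : numClosedFieldType) (n : nat) (e : C) (a c : nat -> C) :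
    'M[C]_n.+1 :=
  \matrix_(i < n.+1, j < n.+1)
    if j == i then
      if i == 0%N :> nat then e * a 1%N
      else if i == n :> nat then e * c 0%N
      else 0
    else if j == i.+1 :> nat then c i.+1
    else if i == j.+1 :> nat then a i.+1
    else 0.

(* Main.v *)
(** The closure of [W(T)] and the hull [K] of [W(A^+)] and [W(A^-)] are closed and
    convex, so it suffices to compare suprema in each real direction [(p, q)].
    There, conjugating by a diagonal unitary turns a tridiagonal quadratic form
    into the real form with the bonds
    [d_j = |(p - i q) c_j + (p + i q) a_(j+1)|],
    evaluated at the moduli of the coordinates. The hypotheses say precisely that
    [d] is a palindrome on [1, n]. The better of the two matrices contributes
    [sum_(j = 1)^n d_j r_(j-1) r_j + (d_0 / 2) (r_0^2 + r_n^2)], and AM-GM at the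
    bonds [d_0] cuts the form of [T] into such blocks. Conversely, in the
    concatenation of [r], its reversal, [r], ... neighbouring blocks agree at the
    common bond, so no mass is lost there and the Rayleigh quotients of [T] tend
    to that of the block. *)
From mathcomp Require Import zify ring lra.
Require Import Defs.
Import Order.TTheory GRing.Theory Num.Theory.
Set Implicit Arguments.
Unset Strict Implicit.
Unset Printing Implicit Defensive.
Local Open Scope classical_set_scope.
Local Open Scope ring_scope.

(** * Real quadratic forms of chains and blocks *)

Definition chain (R : realFieldType) (d : nat -> R) (N : nat) (r : nat -> R) : R :=
  \sum_(j < N) d j * (r j * r j.+1).

(** Each end carries half of a bond [d 0], its share when AM-GM splits the bond between two
    blocks. *)
Definition block_form (R : realFieldType) (d : nat -> R) (n : nat) (r : nat -> R) : R :=
  \sum_(j < n) d j.+1 * (r j * r j.+1) + d 0%N / 2 * (r 0%N ^+ 2 + r n ^+ 2).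

Definition sqnorm (R : realFieldType) (N : nat) (r : nat -> R) : R :=
  \sum_(j < N) r j ^+ 2.

Lemma sqnorm_ge0 (R : realFieldType) N (r : nat -> R) : 0 <= sqnorm N r.
Proof. by apply: sumr_ge0 => i _; exact: sqr_ge0. Qed.

Lemma periodic_mul (T : Type) (p : nat) (u : nat -> T) :
  periodic p u -> forall m k, u (m * p + k)%N = u k.
Proof.
move=> u_per m k; elim: m => [//|m IH].
by rewrite (_ : _ + k = m * p + k + p)%N ?u_per//; lia.
Qed.

Lemma chain_add (R : realFieldType) (d : nat -> R) N K r :
  chain d (N + K) r = chain d N r + chain (d \o addn N) K (r \o addn N).
Proof.
rewrite /chain big_split_ord /=; congr (_ + _).
by apply: eq_bigr => i _; rewrite addnS.
Qed.

Lemma sqnorm_add (R : realFieldType) N K (r : nat -> R) :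
  sqnorm (N + K) r = sqnorm N r + sqnorm K (r \o addn N).
Proof. by rewrite /sqnorm big_split_ord. Qed.

(** Sites [m * n.+1 + 1] to [m.+1 * n.+1] form one block; by periodicity its inner bonds are
    [d 1, ..., d n] and the bond to the preceding site is [d 0]. The half bond on the left-hand side
    is the right end term of this block; its left end term is subtracted again. *)
Lemma chain_step (R : realFieldType) n (d : nat -> R) m r :
  periodic n.+1 d ->
  chain d (m.+1 * n.+1) r + d 0%N / 2 * r (m.+1 * n.+1)%N ^+ 2 =
  chain d (m * n.+1) r
  + d 0%N * (r (m * n.+1)%N * r (m * n.+1).+1)
  - d 0%N / 2 * r (m * n.+1).+1 ^+ 2
  + block_form d n (r \o addn (m * n.+1).+1).
Proof.
move=> d_per; rewrite {1}mulSnr chain_add.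
rewrite /chain big_ord_recl /= addn0 addn1 /block_form /= addn0.
rewrite [d (_ * _)%N](_ : _ = d 0%N); last first.
  by rewrite -(periodic_mul d_per m 0) addn0.
rewrite (_ : m.+1 * n.+1 = (m * n.+1).+1 + n)%N; last by lia.
rewrite (eq_bigr (fun j : 'I_n => d j.+1 *
    (r ((m * n.+1).+1 + j)%N * r ((m * n.+1).+1 + j.+1)%N))); last first.
  move=> i _; rewrite /bump /= add1n (periodic_mul d_per).
  by rewrite !addnS !addSn.
ring.
Qed.

(* Only the bonds linking consecutive blocks are estimated, by AM-GM; site 0 is
   the last site of an otherwise empty block. *)
Lemma chain_le_of_block (R : realFieldType) n (d : nat -> R) M :
  periodic n.+1 d -> 0 <= d 0%N ->
  (forall r, block_form d n r <= M * sqnorm n.+1 r) ->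
  forall N r, chain d N r <= M * sqnorm N.+1 r.
Proof.
move=> d_per d0 hB N r.
have claim m s : chain d (m * n.+1) s + d 0%N / 2 * s (m * n.+1)%N ^+ 2
    <= M * sqnorm (m * n.+1).+1 s.
  elim: m => [|m IH].
    rewrite mul0n /chain big_ord0 add0r /sqnorm big_ord1.
    (* The base case is read off from a block with [s 0] at its last site and zeros elsewhere; for
       [n = 0] its two ends coincide. *)
    have := hB (fun j => if j == n then s 0%N else 0).
    rewrite /block_form /sqnorm big_ord_recr/= eqxx big1 ?add0r; last first.
      by move=> i _; rewrite ltn_eqF ?mul0r ?mulr0.
    rewrite big1 ?add0r; last by move=> i _; rewrite ltn_eqF // expr0n.
    apply: le_trans; rewrite ler_wpM2l ?divr_ge0 // lerDr.
    by case: ifP => _; rewrite sqr_ge0.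
  rewrite chain_step //.
  have := hB (s \o addn (m * n.+1).+1).
  rewrite mulSnr -addSn sqnorm_add mulrDr.
  set x := s (m * n.+1)%N in IH *; set y := s _.+1 => h2.
  have amgm : d 0%N * (x * y) <= d 0%N / 2 * x ^+ 2 + d 0%N / 2 * y ^+ 2.
    rewrite -subr_ge0 (_ : _ - _ = d 0%N / 2 * (x - y) ^+ 2); last by field.
    by rewrite mulr_ge0 ?divr_ge0 ?sqr_ge0.
  lra.
(* Padding [r] with zeros, up to [N] whole blocks after site 0, changes neither [chain] nor
   [sqnorm]. *)
pose s j := if (j <= N)%N then r j else 0.
have := claim N s.
have -> : (N * n.+1 = N + N * n)%N by rewrite mulnS.
have s0 j : (N < j)%N -> s j = 0 by rewrite /s ltnNge => /negbTE ->.
have -> : chain d (N + N * n) s = chain d N r.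
  rewrite chain_add [X in _ + X]big1 ?addr0.
    by apply: eq_bigr => i _; rewrite /s ltn_ord ltnW.
  by move=> i _; rewrite /= (s0 (_ + _.+1)%N) ?mulr0 //; lia.
have -> : sqnorm (N + N * n).+1 s = sqnorm N.+1 r.
  rewrite -addSn sqnorm_add [X in _ + X]big1 ?addr0.
    by apply: eq_bigr => i _; rewrite /s -ltnS ltn_ord.
  by move=> i _; rewrite /= (s0 (_.+1 + _)%N) ?expr0n //; lia.
by apply: le_trans; rewrite lerDl mulr_ge0 ?divr_ge0 ?sqr_ge0.
Qed.

(** * Alternating concatenation of a block and its reversal *)

(** Site 0 repeats [r 0], as if a reversed block ended there; block number [m] fills the sites
    [m * n.+1 + 1] to [m.+1 * n.+1], reversed for odd [m]. *)
Definition reflected (R : Type) (n : nat) (r : nat -> R) (k : nat) : R :=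
  if k is j.+1 then
    if odd (j %/ n.+1) then r (n - j %% n.+1)%N else r (j %% n.+1)%N
  else r 0%N.

Lemma reflected_block (R : Type) n (r : nat -> R) m i : (i <= n)%N ->
  reflected n r ((m * n.+1).+1 + i)%N = if odd m then r (n - i)%N else r i.
Proof.
by move=> lein; rewrite /reflected addSn divnMDl // divn_small // addn0 modnMDl modn_small.
Qed.

(** A block ends with [r n] or [r 0], and the opposite orientation of the next one makes it start
    with the same value. *)
Lemma reflected_join (R : Type) n (r : nat -> R) m :
  reflected n r (m * n.+1) = reflected n r (m * n.+1).+1.
Proof.
have := @reflected_block _ n r m 0 (leq0n _); rewrite addn0 subn0 => ->.
case: m => [//|m]; have -> : (m.+1 * n.+1 = (m * n.+1).+1 + n)%N by lia.
by rewrite (reflected_block r m (leqnn n)) subnn /=; case: odd.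
Qed.

Lemma sqnorm_rev (R : realFieldType) n (r : nat -> R) :
  sqnorm n.+1 (fun i => r (n - i)%N) = sqnorm n.+1 r.
Proof. by rewrite /sqnorm [RHS](reindex_inj rev_ord_inj). Qed.

(** Reversal carries bond [j] to bond [n + 1 - j]; this is where the palindrome enters. *)
Lemma block_form_rev (R : realFieldType) n (d : nat -> R) r :
  (forall j, (1 <= j <= n)%N -> d j = d (n.+1 - j)%N) ->
  block_form d n (fun i => r (n - i)%N) = block_form d n r.
Proof.
move=> pal; rewrite /block_form subn0 subnn [r n ^+ 2 + _]addrC; congr (_ + _).
rewrite [RHS](reindex_inj rev_ord_inj) /=; apply: eq_bigr => i _.
have i_lt := ltn_ord i.
rewrite pal //= (_ : n.+1 - i.+1 = (n - i.+1).+1)%N; last by lia.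
by rewrite (_ : (n - i.+1).+1 = n - i)%N 1?[r _ * _]mulrC //; lia.
Qed.

Lemma eq_block_form (R : realFieldType) n (d : nat -> R) r s :
  (forall i, (i <= n)%N -> r i = s i) -> block_form d n r = block_form d n s.
Proof.
move=> rs; rewrite /block_form !rs //; congr (_ + _).
by apply: eq_bigr => i _; rewrite !rs // ltnW.
Qed.

Lemma eq_sqnorm (R : realFieldType) n (r s : nat -> R) :
  (forall i, (i <= n)%N -> r i = s i) -> sqnorm n.+1 r = sqnorm n.+1 s.
Proof. by move=> rs; apply: eq_bigr => i _; rewrite rs // -ltnS. Qed.

(* In the concatenation r, rev r, r, ... neighbouring blocks agree at their
   common bond, where AM-GM is therefore an equality. *)
Lemma block_le_of_chain (R : archiRealFieldType) n (d : nat -> R) M :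
  periodic n.+1 d -> 0 <= d 0%N ->
  (forall j, (1 <= j <= n)%N -> d j = d (n.+1 - j)%N) ->
  (forall N r, chain d N r <= M * sqnorm N.+1 r) ->
  forall r, block_form d n r <= M * sqnorm n.+1 r.
Proof.
move=> d_per d0 pal hC r; pose s := reflected n r.
have blk m : block_form d n (s \o addn (m * n.+1).+1) = block_form d n r /\
    sqnorm n.+1 (s \o addn (m * n.+1).+1) = sqnorm n.+1 r.
  case: (boolP (odd m)) => om.
    have E i : (i <= n)%N -> (s \o addn (m * n.+1).+1) i = r (n - i)%N.
      by move=> lein; rewrite /s /comp reflected_block // om.
    by rewrite (eq_block_form _ E) block_form_rev // (eq_sqnorm E) sqnorm_rev.
  have E i : (i <= n)%N -> (s \o addn (m * n.+1).+1) i = r i.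
    by move=> lein; rewrite /s /comp reflected_block // (negbTE om).
  by rewrite (eq_block_form _ E) // (eq_sqnorm E).
(* The two sites at a joint carry equal values, so the bond [d 0] minus the left end term leaves the
   half bond of the previous step: every block adds exactly one [block_form]. *)
have form m : chain d (m * n.+1) s + d 0%N / 2 * s (m * n.+1)%N ^+ 2 =
    m%:R * block_form d n r + d 0%N / 2 * r 0%N ^+ 2.
  elim: m => [|m IH].
    by rewrite mul0n /chain big_ord0 mul0r.
  rewrite chain_step // (blk m).1 -[m.+1%:R]natr1; move: IH; rewrite /s reflected_join -/s.
  by lra.
have nrm m : sqnorm (m * n.+1).+1 s = m%:R * sqnorm n.+1 r + r 0%N ^+ 2.
  elim: m => [|m IH]; first by rewrite mul0n /sqnorm big_ord1 mul0r add0r.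
  by rewrite mulSnr -addSn sqnorm_add IH (blk m).2 -[m.+1%:R]natr1; ring.
have s_le m : s (m * n.+1)%N ^+ 2 <= r 0%N ^+ 2 + r n ^+ 2.
  have := @reflected_block _ n r m 0 (leq0n _); rewrite addn0 subn0 /s reflected_join => ->.
  by case: ifP => _; rewrite ?lerDl ?lerDr sqr_ge0.
(* [K] collects the end terms, bounded independently of [m]; [m] times a positive gap would outgrow
   it. *)
pose K := M * r 0%N ^+ 2 + d 0%N / 2 * (r 0%N ^+ 2 + r n ^+ 2) - d 0%N / 2 * r 0%N ^+ 2.
have key m : m%:R * (block_form d n r - M * sqnorm n.+1 r) <= K.
  have h1 := hC (m * n.+1)%N s; rewrite nrm in h1.
  have h2 := form m.
  have h3 : d 0%N / 2 * s (m * n.+1)%N ^+ 2 <= d 0%N / 2 * (r 0%N ^+ 2 + r n ^+ 2).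
    by rewrite ler_wpM2l ?divr_ge0.
  rewrite /K; lra.
rewrite -subr_le0 leNgt; apply/negP => gap.
have := key (Num.bound `|K / (block_form d n r - M * sqnorm n.+1 r)|).
apply/negP; rewrite -ltNge -ltr_pdivrMr //.
exact: le_lt_trans (ler_norm _) (archi_boundP (normr_ge0 _)).
Qed.

(** * The inner product on [C^n] and convexity of matrix numerical ranges *)

Lemma conjcD (C : numClosedFieldType) (x y : C) :
  Num.conj (x + y) = Num.conj x + Num.conj y.
Proof. exact: rmorphD. Qed.

Lemma conjcM (C : numClosedFieldType) (x y : C) :
  Num.conj (x * y) = Num.conj x * Num.conj y.
Proof. exact: rmorphM. Qed.

Lemma conjcN (C : numClosedFieldType) (x : C) : Num.conj (- x) = - Num.conj x.
Proof. exact: rmorphN. Qed.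

Lemma cdotDl (C : numClosedFieldType) n (x y z : 'cV[C]_n) :
  cdot (x + y) z = cdot x z + cdot y z.
Proof. by rewrite /cdot -big_split; apply: eq_bigr => i _; rewrite mxE mulrDl. Qed.

Lemma cdotZl (C : numClosedFieldType) n k (x z : 'cV[C]_n) :
  cdot (k *: x) z = k * cdot x z.
Proof. by rewrite /cdot mulr_sumr; apply: eq_bigr => i _; rewrite mxE mulrA. Qed.

Lemma cdotC (C : numClosedFieldType) n (x z : 'cV[C]_n) :
  cdot x z = Num.conj (cdot z x).
Proof.
rewrite /cdot rmorph_sum; apply: eq_bigr => i _ /=.
by rewrite conjcM conjCK mulrC.
Qed.

Lemma cdotDr (C : numClosedFieldType) n (x y z : 'cV[C]_n) :
  cdot z (x + y) = cdot z x + cdot z y.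
Proof. by rewrite cdotC cdotDl conjcD -!cdotC. Qed.

Lemma cdotZr (C : numClosedFieldType) n k (x z : 'cV[C]_n) :
  cdot z (k *: x) = Num.conj k * cdot z x.
Proof. by rewrite cdotC cdotZl conjcM -cdotC. Qed.

Lemma cdot_sqnorm (C : numClosedFieldType) n (x : 'cV[C]_n) :
  cdot x x = \sum_i `|x i 0| ^+ 2.
Proof. by apply: eq_bigr => i _; rewrite normCK. Qed.

Lemma cdot_ge0 (C : numClosedFieldType) n (x : 'cV[C]_n) : 0 <= cdot x x.
Proof. by rewrite cdot_sqnorm sumr_ge0 // => i _; rewrite exprn_ge0. Qed.

Lemma cdot_eq0 (C : numClosedFieldType) n (x : 'cV[C]_n) :
  (cdot x x == 0) = (x == 0).
Proof.
apply/eqP/eqP => [|->]; last first.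
  by rewrite /cdot big1 // => i _; rewrite mxE mul0r.
rewrite cdot_sqnorm => /eqP.
rewrite psumr_eq0 => [/allP x0|i _]; last by rewrite exprn_ge0.
apply/matrixP => i j; rewrite mxE (ord1 j); apply/eqP.
by have := x0 i (mem_index_enum i); rewrite sqrf_eq0 normr_eq0.
Qed.

Lemma mx_numerical_rangeE (C : numClosedFieldType) n (A : 'M[C]_n) w :
  mx_numerical_range A w <->
  exists2 v, cdot v v = 1 & cdot (A *m v) v = w.
Proof.
split=> [[v [_ v1] <-]|[v v1 <-]]; last by exists v => //; split => //; rewrite v1 sqrtC1.
by exists v => //; rewrite -[LHS]sqrtCK v1 expr1n.
Qed.

Lemma mx_numerical_range_Rayleigh (C : numClosedFieldType) n (A : 'M[C]_n) v w :
  v != 0 -> cdot (A *m v) v = w * cdot v v -> mx_numerical_range A w.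
Proof.
move=> v0 Aw; have N0 : cdot v v != 0 by rewrite cdot_eq0.
set k := (sqrtC (cdot v v))^-1.
have kk : k * Num.conj k * cdot v v = 1.
  have kr : Num.conj k = k.
    by apply/CrealP; rewrite ger0_real // invr_ge0 sqrtC_ge0 cdot_ge0.
  by rewrite kr -expr2 exprVn sqrtCK mulVf.
apply/mx_numerical_rangeE; exists (k *: v).
  by rewrite cdotZl cdotZr mulrA kk.
by rewrite -scalemxAr cdotZl cdotZr Aw mulrA mulrCA kk mulr1.
Qed.

(** An affine change of the matrix moves [z] and [w] to 0 and 1. Along a path from a multiple of [x]
    to [y] on which the new form is real, the intermediate value theorem yields the Rayleigh
    quotient [t]. *)
Lemma Toeplitz_Hausdorff (R : realType) n (A : 'M[R[i]]_n) z w (t : R) :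
  0 <= t -> t <= 1 -> mx_numerical_range A z -> mx_numerical_range A w ->
  mx_numerical_range A ((1 - t)%:C%C * z + t%:C%C * w).
Proof.
move=> t0 t1 /mx_numerical_rangeE[x x1 Az] /mx_numerical_rangeE[y y1 Aw].
have [<-|zw] := eqVneq z w.
  rewrite -mulrDl -rmorphD /= subrK mul1r; apply/mx_numerical_rangeE.
  by exists x.
have wz : w - z != 0 by rewrite subr_eq0 eq_sym.
pose B := (w - z)^-1 *: (A - z%:M).
have AE v : cdot (A *m v) v = (w - z) * cdot (B *m v) v + z * cdot v v.
  rewrite -scalemxAl cdotZl mulrA divff // mul1r mulmxBl mul_scalar_mx.
  by rewrite cdotDl -scaleNr cdotZl mulNr subrK.
have Bx : cdot (B *m x) x = 0.
  have := AE x; rewrite Az x1 mulr1 -[X in X = _]add0r => /addIr /esym/eqP.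
  by rewrite mulf_eq0 (negbTE wz) => /eqP.
have By : cdot (B *m y) y = 1.
  have := AE y; rewrite Aw y1 mulr1 => /eqP; rewrite -subr_eq => /eqP E.
  by apply: (mulfI wz); rewrite -E mulr1.
pose P := cdot (B *m x) y; pose Q := cdot (B *m y) x; pose g := cdot x y.
(* This makes the cross terms of the B-form real along the path below. *)
pose phi := if Num.conj P == Q then 1 else Num.conj P - Q.
have phi0 : phi != 0.
  by rewrite /phi; case: (eqVneq (Num.conj P) Q) => [_|]; rewrite ?oner_neq0 // subr_eq0.
pose k (s : R) : R[i] := s%:C%C.
have kJ s : Num.conj (k s) = k s by exact: conjc_real.
have real_k u : Num.conj u = u -> exists s, u = k s.
  by move=> /CrealP /complex_realP.
have kD s u : k (s + u) = k s + k u by exact: rmorphD.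
have kM s u : k (s * u) = k s * k u by exact: rmorphM.
have kX s : k (s ^+ 2) = k s ^+ 2 by exact: rmorphXn.
have k1s s : k (1 - s) = 1 - k s by exact: (rmorphB (real_complex R) 1 s).
have [r rE] : exists r, phi * P + Num.conj phi * Q = k r.
  apply: real_k; rewrite /phi; case: eqVneq => [<-|_].
    by rewrite conjC1 !mul1r conjcD conjCK addrC.
  by rewrite !(conjcD, conjcM, conjcN, conjCK); ring.
have [h hE] : exists h, phi * g + Num.conj phi * Num.conj g = k h.
  by apply: real_k; rewrite !(conjcD, conjcM, conjCK) addrC.
have [f fE] : exists f, phi * Num.conj phi = k f.
  by apply: real_k; rewrite conjcM conjCK mulrC.
have f0 : 0 <= f by rewrite -ler0c -/(k f) -fE mul_conjC_ge0.
pose v s := (k (1 - s) * phi) *: x + k s *: y.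
have Bv s : cdot (B *m v s) (v s) = k (s ^+ 2 + s * (1 - s) * r).
  rewrite /v mulmxDr -!scalemxAr !cdotDl !cdotDr !cdotZl !cdotZr Bx By -/P -/Q.
  by rewrite conjcM !kJ !(k1s, kD, kM, kX) -rE; ring.
have Nv s : cdot (v s) (v s) = k ((1 - s) ^+ 2 * f + s ^+ 2 + s * (1 - s) * h).
  rewrite /v !cdotDl !cdotDr !cdotZl !cdotZr x1 y1 -/g (cdotC y x) -/g.
  by rewrite conjcM !kJ !(k1s, kD, kM, kX) -hE -fE; ring.
(* Cleared of its denominator, the equation for the Rayleigh quotient is polynomial in [s]; the
   difference of its sides is [- t * f <= 0] at 0 and [1 - t >= 0] at 1. *)
have [s [s0 s1 sE]] : exists s, [/\ 0 <= s, s <= 1 & s ^+ 2 + s * (1 - s) * r =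
    t * ((1 - s) ^+ 2 * f + s ^+ 2 + s * (1 - s) * h)].
  pose p : {poly R} := 'X ^+ 2 + 'X * (1 - 'X) * r%:P -
     t%:P * ((1 - 'X) ^+ 2 * f%:P + 'X ^+ 2 + 'X * (1 - 'X) * h%:P).
  have pE s : p.[s] = s ^+ 2 + s * (1 - s) * r -
     t * ((1 - s) ^+ 2 * f + s ^+ 2 + s * (1 - s) * h) by rewrite /p !hornerE.
  have [|s /andP[s0 s1]] := @poly_ivt R p 0 1 ler01.
    by rewrite !pE; apply/andP; split; [have := mulr_ge0 t0 f0|]; lra.
  by rewrite rootE pE subr_eq0 => /eqP E; exists s.
(* For [s = 1] the vector is [y]; otherwise [v s = 0] would make [x] a multiple of [y] by a number
   of modulus 1, with [B]-form 1 instead of 0. *)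
have vN0 : v s != 0.
  apply/eqP => vs0.
  have [s1E|s1N] := eqVneq s 1.
    move: vs0 y1; rewrite /v s1E subrr /k rmorph0 mul0r scale0r add0r rmorph1 scale1r => ->.
    by rewrite /cdot big1 => [/esym/eqP|i _]; rewrite ?oner_eq0 // mxE mul0r.
  have c0 : k (1 - s) * phi != 0.
    by rewrite mulf_neq0 // fmorph_eq0 subr_eq0 eq_sym.
  have xE : x = (- k s / (k (1 - s) * phi)) *: y.
    apply: (scalerI c0); rewrite scalerA mulrCA divff // mulr1 scaleNr.
    by apply/eqP; rewrite -addr_eq0; apply/eqP.
  move: x1 Bx; rewrite xE -scalemxAr !cdotZl !cdotZr By y1 => ->.
  by move/eqP; rewrite oner_eq0.
apply: (mx_numerical_range_Rayleigh vN0).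
by rewrite AE Bv sE Nv kM -!/(k _) k1s; ring.
Qed.

(* [closure] and [limn] find their topology through the numClosedFieldType. *)
Notation cplx R := (Num.ClosedField.sort (R[i]%type : numClosedFieldType)).

(** * Closure and separation in the complex plane *)

Lemma sqr_norm_complex (R : rcfType) (z : R[i]) :
  `|z| ^+ 2 = (complex.Re z ^+ 2 + complex.Im z ^+ 2)%:C%C.
Proof. by rewrite -add_Re2_Im2. Qed.

(** Radii of balls in [cplx R] are positive elements of [cplx R], hence real; this reduces closure
    to squared real distances. *)
Lemma closure_complexP (R : realType) (S : set (cplx R)) (z : cplx R) :
  closure S z <-> forall e : R, 0 < e ->
    exists2 w, S w & (complex.Re z - complex.Re w) ^+ 2 + (complex.Im z - complex.Im w) ^+ 2 < e.
Proof.
have dE (w : R[i]) : (complex.Re z - complex.Re w) ^+ 2 + (complex.Im z - complex.Im w) ^+ 2 =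
    complex.Re (z - w) ^+ 2 + complex.Im (z - w) ^+ 2 by case: (z : R[i]) w => a b [].
split=> [clz e e0|clz B /nbhs_ballP[e e0 eB]].
  have se0 : 0 < (Num.sqrt e)%:C%C :> cplx R by rewrite ltcR sqrtr_gt0.
  have [w [Sw /= zw]] := clz _ (nbhsx_ballx z _ se0).
  exists w => //; rewrite dE -ltcR -sqr_norm_complex -[e in X in _ < X]sqr_sqrtr ?ltW //.
  by rewrite rmorphXn ltr_pXn2r ?nnegrE // ltW.
have eE : e = (complex.Re (e : R[i]))%:C%C by rewrite RRe_real // gtr0_real.
have e0' : 0 < complex.Re (e : R[i]) by rewrite -ltcR -eE.
have [w Sw zw] := clz _ (exprn_gt0 2 e0').
exists w; split => //; apply: eB; rewrite /ball /=.
rewrite -(@ltr_pXn2r _ 2) ?nnegrE // ?ltW // eE.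
by rewrite sqr_norm_complex -rmorphXn ltcR -dE.
Qed.

(** The real part of [(p - i q) z]; the direction [(p, q)] need not have length 1. *)
Definition support (R : realType) (p q : R) (z : R[i]) : R :=
  p * complex.Re z + q * complex.Im z.

Lemma Re_lin (R : realType) (s t : R) (x y : R[i]) :
  complex.Re (s%:C%C * x + t%:C%C * y) = s * complex.Re x + t * complex.Re y.
Proof. by case: x y => a b [a' b'] /=; rewrite !mul0r !subr0. Qed.

Lemma Im_lin (R : realType) (s t : R) (x y : R[i]) :
  complex.Im (s%:C%C * x + t%:C%C * y) = s * complex.Im x + t * complex.Im y.
Proof. by case: x y => a b [a' b'] /=; rewrite !mul0r !addr0. Qed.

(* A near-minimiser w0 of the distance to z suffices: z - w0 separates up to an
   error that boundedness of S makes small. *)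
Lemma separation (R : realType) (S : set (cplx R)) (z : cplx R) (B : R) :
  (forall w, S w -> complex.Re w ^+ 2 + complex.Im w ^+ 2 <= B) -> S !=set0 ->
  (forall x y (t : R), 0 <= t -> t <= 1 -> S x -> S y ->
     S ((1 - t)%:C%C * x + t%:C%C * y)) ->
  ~ closure S z ->
  exists p q M, (forall w, S w -> support p q w <= M) /\ M < support p q z.
Proof.
move=> SB [v0 Sv0] Sconv /closure_complexP/existsNP[e /not_implyP[e0 far]].
pose dist (w : R[i]) := (complex.Re z - complex.Re w) ^+ 2 +
  (complex.Im z - complex.Im w) ^+ 2.
pose E : set R := dist @` S; pose d := inf E.
have distE w : S w -> e <= dist w.
  by move=> Sw; rewrite leNgt; apply/negP => ?; apply: far; exists w.
have Einf : has_inf E.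
  by split; [exists (dist v0), v0|exists e => _ [w Sw <-]; exact: distE].
have dE w : S w -> d <= dist w by move=> Sw; apply: ge_inf; [case: Einf|exists w].
have d0 : 0 < d.
  apply: (lt_le_trans e0); apply: lb_le_inf; first by case: Einf.
  by move=> _ [w Sw <-]; exact: distE.
have B0 : 0 <= B by apply: le_trans (SB _ Sv0); rewrite addr_ge0 ?sqr_ge0.
(* [4 * B] bounds the squared distance between two points of [S]; adding [d] makes [K] positive and
   [t] at most 1. As [t * K = d / 2], the second-order term of a step of size [t] from [w0] towards
   [w] is at most [t * d / 2]. *)
pose K := 4 * B + d; have K0 : 0 < K by rewrite /K; lra.
pose t := d / (2 * K).
have tK : t * K = d / 2 by rewrite /t; field; rewrite gt_eqF.
have t0 : 0 < t by rewrite divr_gt0 // mulr_gt0.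
have t1 : t <= 1 by rewrite ler_pdivrMr ?mulr_gt0 // /K; lra.
have td0 : 0 < t * d / 2 by apply: divr_gt0 => //; exact: mulr_gt0.
have [_ [w0 Sw0 <-] w0d] := inf_adherent td0 Einf.
exists (complex.Re z - complex.Re w0), (complex.Im z - complex.Im w0).
exists (support (complex.Re z - complex.Re w0) (complex.Im z - complex.Im w0) w0 + d / 2).
split=> [w Sw|]; last first.
  by have := dE _ Sw0; rewrite /support /dist !expr2; lra.
have := dE _ (Sconv _ _ _ (ltW t0) t1 Sw0 Sw).
have := SB _ Sw; have := SB _ Sw0; move: w0d.
rewrite -/d /dist /support Re_lin Im_lin.
move: (complex.Re z) (complex.Im z) (complex.Re w0) (complex.Im w0) => a b x y.
move: (complex.Re w) (complex.Im w) => x' y' near hw0 hw hd.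
have vK : (x' - x) ^+ 2 + (y' - y) ^+ 2 <= K.
  have := sqr_ge0 (x' + x); have := sqr_ge0 (y' + y); rewrite /K; nra.
have tvK : t * (t * ((x' - x) ^+ 2 + (y' - y) ^+ 2)) <= t * (d / 2).
  by rewrite -tK !ler_pM2l.
(* The squared distance from [z] is at least [d] after the step and less than [d + t * d / 2] before
   it, so the first-order term is at most [t * d]. *)
have : t * (2 * ((a - x) * (x' - x) + (b - y) * (y' - y))) <= t * d.
  rewrite -subr_ge0 in hd.
  suff : t * (2 * ((a - x) * (x' - x) + (b - y) * (y' - y))) =
    (a - x) ^+ 2 + (b - y) ^+ 2 - ((a - ((1 - t) * x + t * x')) ^+ 2 +
      (b - ((1 - t) * y + t * y')) ^+ 2)
    + t * (t * ((x' - x) ^+ 2 + (y' - y) ^+ 2)) by lra.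
  by ring.
by rewrite ler_pM2l //; lra.
Qed.

(** * Compactness of matrix numerical ranges *)

Definition ccontinuous (R : realType) (T : topologicalType) (f : T -> R[i]) :=
  continuous (fun v => complex.Re (f v)) /\ continuous (fun v => complex.Im (f v)).

Lemma ccontinuous_cst (R : realType) (T : topologicalType) (z : R[i]) :
  @ccontinuous R T (fun=> z).
Proof. by split=> v; exact: cvg_cst. Qed.

Lemma ccontinuousD (R : realType) (T : topologicalType) (f g : T -> R[i]) :
  ccontinuous f -> ccontinuous g -> ccontinuous (fun v => f v + g v).
Proof.
move=> [f1 f2] [g1 g2]; split=> v.
  rewrite (_ : (fun _ => _) = (fun v => complex.Re (f v)) \+ (fun v => complex.Re (g v))).
    by apply: cvgD; [exact: f1|exact: g1].
  by apply/funext => u /=; case: (f u) (g u) => ? ? [].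
rewrite (_ : (fun _ => _) = (fun v => complex.Im (f v)) \+ (fun v => complex.Im (g v))).
  by apply: cvgD; [exact: f2|exact: g2].
by apply/funext => u /=; case: (f u) (g u) => ? ? [].
Qed.

Lemma ccontinuousM (R : realType) (T : topologicalType) (f g : T -> R[i]) :
  ccontinuous f -> ccontinuous g -> ccontinuous (fun v => f v * g v).
Proof.
move=> [f1 f2] [g1 g2]; split=> v.
  rewrite (_ : (fun _ => _) =
    (fun v => complex.Re (f v) * complex.Re (g v) - complex.Im (f v) * complex.Im (g v))).
    by apply: cvgB; apply: cvgM; [exact: f1|exact: g1|exact: f2|exact: g2].
  by apply/funext => u /=; case: (f u) (g u) => ? ? [].
rewrite (_ : (fun _ => _) =
  (fun v => complex.Re (f v) * complex.Im (g v) + complex.Im (f v) * complex.Re (g v))).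
  by apply: cvgD; apply: cvgM; [exact: f1|exact: g2|exact: f2|exact: g1].
by apply/funext => u /=; case: (f u) (g u) => ? ? [].
Qed.

Lemma ccontinuous_conj (R : realType) (T : topologicalType) (f : T -> R[i]) :
  ccontinuous f -> ccontinuous (fun v => Num.conj (f v)).
Proof.
move=> [f1 f2]; split=> v.
  rewrite (_ : (fun _ => _) = (fun v => complex.Re (f v))); first exact: f1.
  by apply/funext => u; case: (f u).
rewrite (_ : (fun _ => _) = (fun v => - complex.Im (f v))).
  by apply: cvgN; exact: f2.
by apply/funext => u; case: (f u).
Qed.

Lemma ccontinuous_sum (R : realType) (T : topologicalType) (I : Type) (s : seq I)
    (f : I -> T -> R[i]) :
  (forall i, ccontinuous (f i)) -> ccontinuous (fun v => \sum_(i <- s) f i v).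
Proof.
move=> fc; elim: s => [|i s IH].
  rewrite (_ : (fun _ => _) = fun=> 0); first exact: ccontinuous_cst.
  by apply/funext => v; rewrite big_nil.
rewrite (_ : (fun _ => _) = fun v => f i v + \sum_(i <- s) f i v).
  exact: ccontinuousD.
by apply/funext => v; rewrite big_cons.
Qed.

Definition unit_sphere (R : realType) m : set 'rV[R]_m :=
  [set v | \sum_k v 0 k ^+ 2 = 1].

(** A closed part of the cube [[-1, 1]^m], which is a compact product of segments. *)
Lemma unit_sphere_compact (R : realType) m : compact (@unit_sphere R m).
Proof.
have cube : compact [set v : 'rV[R]_m | forall i, `[-1, 1]%classic (v ord0 i)].
  by apply: (@rV_compact R m (fun=> `[-1, 1]%classic)) => _; exact: segment_compact.
apply: subclosed_compact cube _.
  have sqc (s : seq 'I_m) : continuous (fun v : 'rV[R]_m => \sum_(k <- s) v 0 k ^+ 2).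
    elim: s => [|k s IH].
      have -> : (fun v : 'rV[R]_m => \sum_(k <- [::]) v 0 k ^+ 2) = fun=> 0.
        by apply/funext => v; rewrite big_nil.
      exact: cst_continuous.
    have -> : (fun v : 'rV[R]_m => \sum_(j <- k :: s) v 0 j ^+ 2) =
        fun v => v 0 k * v 0 k + \sum_(j <- s) v 0 j ^+ 2.
      by apply/funext => v; rewrite big_cons expr2.
    have kc : continuous (fun v : 'rV[R]_m => v 0 k) by exact: coord_continuous.
    by move=> v; exact: (cvgD (cvgM (kc v) (kc v)) (IH v)).
  have /continuous_closedP/(_ [set x | x = 1]) := sqc (index_enum 'I_m).
  by move/(_ (@closed_eq _ 1)).
move=> v v1 i; rewrite /= in_itv /= -ler_norml -(@expr_le1 _ 2) //.
rewrite real_normK ?num_real // -v1 (bigD1 i) //= lerDl.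
by apply: sumr_ge0 => k _; exact: sqr_ge0.
Qed.

(** Identifies [R^(2m)] with [C^m], so that the unit vectors of [C^m] come from a compact real
    sphere. *)
Definition cvec (R : realType) m (v : 'rV[R]_(m + m)) : 'cV[R[i]]_m :=
  \col_j Complex (v 0 (lshift m j)) (v 0 (rshift m j)).

Lemma cvec_surj (R : realType) m (x : 'cV[R[i]]_m) : exists v, x = cvec v.
Proof.
exists (row_mx (\row_j complex.Re (x j 0)) (\row_j complex.Im (x j 0))).
apply/matrixP => i j; rewrite !mxE (unsplitK (inl i)) (unsplitK (inr i)) /= !mxE (ord1 j).
by case: (x i 0).
Qed.

Lemma cdot_cvec (R : realType) m (v : 'rV[R]_(m + m)) :
  cdot (cvec v) (cvec v) = (\sum_k v 0 k ^+ 2)%:C%C.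
Proof.
rewrite big_split_ord /= -big_split rmorph_sum; apply: eq_bigr => i _.
by rewrite mxE /= -sqr_normc sqr_norm_complex.
Qed.

Lemma ccontinuous_form (R : realType) m (A : 'M[R[i]]_m) :
  ccontinuous (fun v : 'rV[R]_(m + m) => cdot (A *m cvec v) (cvec v)).
Proof.
have coordc i : ccontinuous (fun v : 'rV[R]_(m + m) => cvec v i 0).
  split=> v.
    rewrite (_ : (fun _ => _) = fun u : 'rV[R]_(m + m) => u 0 (lshift m i)).
      exact: coord_continuous.
    by apply/funext => u; rewrite mxE.
  rewrite (_ : (fun _ => _) = fun u : 'rV[R]_(m + m) => u 0 (rshift m i)).
    exact: coord_continuous.
  by apply/funext => u; rewrite mxE.
apply: ccontinuous_sum => i; apply: ccontinuousM; last exact: ccontinuous_conj.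
rewrite (_ : (fun _ => _) =
  fun v => \sum_(j <- index_enum 'I_m) A i j * (cvec v j 0)).
  apply: ccontinuous_sum => j; apply: ccontinuousM; first exact: ccontinuous_cst.
  exact: coordc.
by apply/funext => v; rewrite mxE.
Qed.

(** The minimum of this function on the sphere serves closedness, its maximum for [z = 0]
    boundedness. *)
Lemma sqdist_form_continuous (R : realType) m (A : 'M[R[i]]_m) (z : R[i]) :
  continuous (fun v : 'rV[R]_(m + m) =>
    (complex.Re z - complex.Re (cdot (A *m cvec v) (cvec v))) ^+ 2 +
    (complex.Im z - complex.Im (cdot (A *m cvec v) (cvec v))) ^+ 2).
Proof.
pose d (v : 'rV[R]_(m + m)) := z + -1 * cdot (A *m cvec v) (cvec v).
have dc : ccontinuous d.
  apply: ccontinuousD; first exact: ccontinuous_cst.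
  by apply: ccontinuousM; [exact: ccontinuous_cst|exact: ccontinuous_form].
have -> : (fun v : 'rV[R]_(m + m) =>
    (complex.Re z - complex.Re (cdot (A *m cvec v) (cvec v))) ^+ 2 +
    (complex.Im z - complex.Im (cdot (A *m cvec v) (cvec v))) ^+ 2) =
    (fun v => complex.Re (d v * Num.conj (d v))).
  apply/funext => v; rewrite /d; case: z {d dc} (cdot _ _) => a b [a' b'] /=.
  by ring.
by have [] := ccontinuousM dc (ccontinuous_conj dc).
Qed.

Lemma mx_numerical_rangeP (R : realType) m (A : 'M[R[i]]_m) w :
  mx_numerical_range A w <->
  exists2 v, unit_sphere v & w = cdot (A *m cvec v) (cvec v).
Proof.
rewrite mx_numerical_rangeE; split=> [[x + <-]|[v v1 ->]].
  by have [v ->] := cvec_surj x; rewrite cdot_cvec => -[v1]; exists v.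
by exists (cvec v); rewrite // cdot_cvec v1.
Qed.

(** The distance to [z] attains its minimum on the compact sphere, and for [z] in the closure this
    minimum is 0. *)
Lemma mx_numerical_range_closed (R : realType) m (A : 'M[R[i]]_m) (z : cplx R) :
  closure (mx_numerical_range A : set (cplx R)) z -> mx_numerical_range A z.
Proof.
move=> /closure_complexP clz.
have [w0 /mx_numerical_rangeP[v0 Sv0 _] _] := clz 1 ltr01.
have [v /set_mem Sv gmin] := compact_EVT_min (ex_intro _ v0 Sv0)
  (@unit_sphere_compact R (m + m)) (continuous_subspaceT (@sqdist_form_continuous R m A z)).
move: gmin; set gv := _ + _ => gmin.
have gv0 : gv <= 0.
  rewrite leNgt; apply/negP => gv0.
  have [w /mx_numerical_rangeP[u Su ->]] := clz _ gv0.
  by rewrite ltNge gmin //; exact: mem_set.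
apply/mx_numerical_rangeP; exists v => //.
have : gv == 0 by rewrite eq_le gv0 addr_ge0 ?sqr_ge0.
rewrite paddr_eq0 ?sqr_ge0 // !sqrf_eq0 !subr_eq0.
by case: (z : R[i]) (cdot _ _) => a b [a' b'] /= /andP[/eqP-> /eqP->].
Qed.

Lemma mx_numerical_range_bounded (R : realType) m (A : 'M[R[i]]_m) :
  exists B, forall w, mx_numerical_range A w ->
    complex.Re w ^+ 2 + complex.Im w ^+ 2 <= B.
Proof.
have [->|/set0P[w0 /mx_numerical_rangeP[v0 Sv0 _]]] :=
  eqVneq (mx_numerical_range A) set0; first by exists 0.
have [v Sv gmax] := compact_EVT_max (ex_intro _ v0 Sv0)
  (@unit_sphere_compact R (m + m)) (continuous_subspaceT (@sqdist_form_continuous R m A 0)).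
eexists => w /mx_numerical_rangeP[u Su ->].
by have := gmax _ (mem_set Su); rewrite /= !sub0r !sqrrN; apply.
Qed.

(** * Tridiagonal operators and their finite truncations *)

Lemma tridiag_opE (C : numClosedFieldType) (a b c x : nat -> C) j :
  tridiag_op a b c x j =
  (if j is i.+1 then a j * x i else 0) + b j * x j + c j * x j.+1.
Proof.
rewrite /tridiag_op !big_ord_recr /= /tridiag_entry !eqxx gtn_eqF //; congr (_ + _ + _).
case: j => [|j]; first by rewrite big_ord0.
rewrite big_ord_recr big1 => [|i _] /=; rewrite ?add0r.
  by rewrite ltn_eqF // ltn_eqF ?eqxx.
have ij := ltn_ord i.
by rewrite !ifF ?mul0r //; apply/eqP; lia.
Qed.

(** Row [N] still reaches column [N + 1]. The resulting last term vanishes on vectors supported on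
    the first [N + 1] sites and, for bounded [c], tends to 0 on [ell2]. *)
Lemma tridiag_formE (C : numClosedFieldType) (a b c x : nat -> C) N :
  \sum_(j < N.+1) tridiag_op a b c x j * Num.conj (x j) =
  \sum_(j < N.+1) b j * `|x j| ^+ 2
  + \sum_(j < N) (c j * x j.+1 * Num.conj (x j) + a j.+1 * x j * Num.conj (x j.+1))
  + c N * x N.+1 * Num.conj (x N).
Proof.
elim: N => [|N IH].
  by rewrite !big_ord1 big_ord0 tridiag_opE add0r addr0 normCK; ring.
rewrite big_ord_recr IH tridiag_opE [in RHS]big_ord_recr /=.
by rewrite [X in _ = _ + X + _]big_ord_recr /= normCK; ring.
Qed.

Definition truncation (C : numClosedFieldType) N (a b c : nat -> C) : 'M[C]_N :=
  \matrix_(i, j) tridiag_entry a b c i j.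

Definition ext (C : numClosedFieldType) N (y : 'cV[C]_N) (k : nat) : C :=
  oapp (fun i : 'I_N => y i 0) 0 (insub k).

Lemma ext_ord (C : numClosedFieldType) N (y : 'cV[C]_N) (i : 'I_N) :
  ext y i = y i 0.
Proof. by rewrite /ext valK. Qed.

Lemma ext_ge (C : numClosedFieldType) N (y : 'cV[C]_N) k :
  (N <= k)%N -> ext y k = 0.
Proof. by move=> Nk; rewrite /ext insubF // ltnNge Nk. Qed.

Lemma ext_col (C : numClosedFieldType) N (x : nat -> C) :
  (forall k, (N <= k)%N -> x k = 0) -> ext (\col_(i < N) x i) = x.
Proof.
move=> x0; apply/funext => k; case: (ltnP k N) => [kN|Nk].
  by rewrite (ext_ord _ (Ordinal kN)) mxE.
by rewrite ext_ge // x0.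
Qed.

Lemma sum_ord_zero_tail (V : nmodType) (F : nat -> V) m n : (m <= n)%N ->
  (forall k, (m <= k)%N -> F k = 0) -> \sum_(k < m) F k = \sum_(k < n) F k.
Proof.
move=> mn F0; rewrite -(subnKC mn) big_split_ord /= [X in _ + X]big1 ?addr0 //.
by move=> i _; rewrite F0 // leq_addr.
Qed.

Lemma truncation_mulmx (C : numClosedFieldType) N (a b c : nat -> C) y (i : 'I_N) :
  (truncation N a b c *m y) i 0 = tridiag_op a b c (ext y) i.
Proof.
pose F k := tridiag_entry a b c i k * ext y k.
rewrite mxE (eq_bigr (fun k : 'I_N => F k)); last first.
  by move=> k _; rewrite mxE /F ext_ord.
(* The sums over [N] and over [i.+2] columns are compared through a common longer range, on which
   all further terms vanish. *)
rewrite (@sum_ord_zero_tail _ F _ (N + i.+2)) ?leq_addr//; last first.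
  by move=> k Nk; rewrite /F ext_ge // mulr0.
rewrite -(@sum_ord_zero_tail _ F i.+2) ?leq_addl// => k ik.
by rewrite /F /tridiag_entry !ifF ?mul0r //; apply/eqP; lia.
Qed.

Lemma truncation_form (C : numClosedFieldType) N (a b c : nat -> C) y :
  cdot (truncation N a b c *m y) y =
  \sum_(j < N) tridiag_op a b c (ext y) j * Num.conj (ext y j).
Proof. by apply: eq_bigr => i _; rewrite truncation_mulmx ext_ord. Qed.

Lemma cdot_ext (C : numClosedFieldType) N (y : 'cV[C]_N) :
  cdot y y = \sum_(j < N) `|ext y j| ^+ 2.
Proof. by rewrite cdot_sqnorm; apply: eq_bigr => i _; rewrite ext_ord. Qed.

(** * Moduli, phases and supports of truncations *)

Definition cmod (R : realType) (z : R[i]) : R :=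
  Num.sqrt (complex.Re z ^+ 2 + complex.Im z ^+ 2).

Lemma cmodE (R : realType) (z : R[i]) : (cmod z)%:C%C = `|z|.
Proof. by rewrite normc_def. Qed.

Lemma cmod_sqr (R : realType) (z : R[i]) : (cmod z ^+ 2)%:C%C = `|z| ^+ 2.
Proof. by rewrite -cmodE -rmorphXn. Qed.

Lemma cmod_ge0 (R : realType) (z : R[i]) : 0 <= cmod z.
Proof. exact: sqrtr_ge0. Qed.

Lemma cmodM (R : realType) (z w : R[i]) : cmod (z * w) = cmod z * cmod w.
Proof. by apply: complexI; rewrite rmorphM /= !cmodE normrM. Qed.

Lemma cmodJ (R : realType) (z : R[i]) : cmod (Num.conj z) = cmod z.
Proof. by case: z => a b; rewrite /cmod /= sqrrN. Qed.

Lemma Re_le_cmod (R : realType) (z : R[i]) : complex.Re z <= cmod z.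
Proof.
apply: le_trans (ler_norm _) _; rewrite -sqrtr_sqr /cmod ler_sqrt ?addr_ge0 ?sqr_ge0 //.
by rewrite lerDl sqr_ge0.
Qed.

Lemma supportD (R : realType) p q (z w : R[i]) :
  support p q (z + w) = support p q z + support p q w.
Proof. by rewrite /support; case: z w => ? ? [? ?] /=; ring. Qed.

Lemma support_sum (R : realType) p q (I : Type) (s : seq I) (F : I -> R[i]) :
  support p q (\sum_(i <- s) F i) = \sum_(i <- s) support p q (F i).
Proof.
by apply: (big_morph _ (supportD p q)); rewrite /support /= !mulr0 addr0.
Qed.

Lemma supportZ (R : realType) p q (t : R) (z : R[i]) :
  support p q (t%:C%C * z) = t * support p q z.
Proof. by rewrite /support; case: z => ? ? /=; ring. Qed.

Definition bond (R : realType) (p q : R) (a c : nat -> R) (j : nat) : R :=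
  cmod (Complex (p * (c j + a j.+1)) (q * (a j.+1 - c j))).

(** Under the real part the second term may be conjugated, which turns both products of coordinates
    into [y] times the conjugate of [x] and merges the two off-diagonal entries into one
    coefficient. *)
Lemma support_bond (R : realType) (p q a c : R) (x y : R[i]) :
  support p q (c%:C%C * y * Num.conj x + a%:C%C * x * Num.conj y) =
  complex.Re (Complex (p * (c + a)) (q * (a - c)) * (y * Num.conj x)).
Proof. by rewrite /support; case: x y => ? ? [? ?] /=; ring. Qed.

(** The diagonal unitary is built site by site: each new phase cancels the argument of one [g k],
    and a path has no cycle that could impose a further condition. *)
Lemma exists_phases (R : realType) (g : nat -> R[i]) :
  exists u : nat -> R[i], (forall k, cmod (u k) = 1) /\
    forall k, g k * (u k.+1 * Num.conj (u k)) = (cmod (g k))%:C%C.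
Proof.
pose h k := if g k == 0 then 1 else Num.conj (g k) / `|g k|.
pose u := fix u k := if k is i.+1 then h i * u i else 1.
have c1 : cmod (1 : R[i]) = 1 by apply: complexI; rewrite cmodE normr1.
have hN k : cmod (h k) = 1.
  rewrite /h; case: eqVneq => [//|gk0]; apply: complexI.
  by rewrite cmodE normrM normfV norm_conjC normr_id divff ?normr_eq0.
have uN k : cmod (u k) = 1.
  by elim: k => [//|k IH] /=; rewrite cmodM hN IH mulr1.
exists u; split => // k /=.
have -> : h k * u k * Num.conj (u k) = h k.
  by rewrite -mulrA -normCK -cmodE uN expr1n mulr1.
rewrite /h cmodE; case: eqVneq => [->|gk0]; first by rewrite mul0r normr0.
by rewrite mulrA -normCK expr2 mulfK ?normr_eq0.
Qed.

Section TruncationSupport.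
Context (R : realType) (p q : R) (a b c : nat -> R) (N : nat).
Let aC k : cplx R := (a k)%:C%C.
Let bC k : cplx R := (b k)%:C%C.
Let cC k : cplx R := (c k)%:C%C.

(** A real diagonal entry is seen only through [p]; nonzero [b] occurs for the corners of [A^+] and
    [A^-]. *)
Let rform (r : nat -> R) : R :=
  \sum_(j < N.+1) p * b j * r j ^+ 2 + chain (bond p q a c) N r.

Lemma support_truncation_form (y : 'cV[cplx R]_N.+1) :
  support p q (cdot (truncation N.+1 aC bC cC *m y) y) =
  \sum_(j < N.+1) p * b j * cmod (ext y j) ^+ 2 +
  \sum_(j < N) complex.Re (Complex (p * (c j + a j.+1)) (q * (a j.+1 - c j)) *
    (ext y j.+1 * Num.conj (ext y j))).
Proof.
rewrite truncation_form tridiag_formE (ext_ge y (leqnn _)) mulr0 mul0r addr0.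
rewrite supportD !support_sum; congr (_ + _); apply: eq_bigr => j _.
  by rewrite -cmod_sqr supportZ /support /= mulr0 addr0 mulrCA mulrA.
exact: support_bond.
Qed.

Lemma cdot_cmod (y : 'cV[cplx R]_N.+1) :
  cdot y y = (sqnorm N.+1 (fun j => cmod (ext y j)))%:C%C.
Proof.
rewrite cdot_ext rmorph_sum; apply: eq_bigr => j _; rewrite -cmod_sqr //.
Qed.

(** Each real part is at most its modulus, so the real form at the moduli of the coordinates
    dominates. *)
Lemma support_truncation_le M :
  (forall r, rform r <= M * sqnorm N.+1 r) ->
  forall w, mx_numerical_range (truncation N.+1 aC bC cC) w -> support p q w <= M.
Proof.
move=> hr w /mx_numerical_rangeE[y y1 <-]; rewrite support_truncation_form.
have := hr (fun j => cmod (ext y j)).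
have -> : sqnorm N.+1 (fun j => cmod (ext y j)) = 1.
  by apply: complexI; rewrite -cdot_cmod y1.
rewrite mulr1; apply: le_trans; rewrite lerD2l; apply: ler_sum => j _.
by apply: le_trans (Re_le_cmod _) _; rewrite !cmodM cmodJ [cmod (ext _ j) * _]mulrC.
Qed.

(** Multiplying [r] by the phases that turn every bond coefficient into its modulus gives a complex
    vector at which the support is exactly [rform r]. *)
Lemma rform_le_of_support M :
  (forall w, mx_numerical_range (truncation N.+1 aC bC cC) w -> support p q w <= M) ->
  forall r, rform r <= M * sqnorm N.+1 r.
Proof.
move=> hw r.
have [u [u1 ug]] := exists_phases (fun j => Complex (p * (c j + a j.+1)) (q * (a j.+1 - c j))).
pose y : 'cV[cplx R]_N.+1 := \col_j ((r j)%:C%C * u j).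
have yE j : (j <= N)%N -> ext y j = (r j)%:C%C * u j.
  by move=> jN; rewrite (ext_ord y (Ordinal (jN : j < N.+1)%N)) mxE.
have y2 j : (j <= N)%N -> cmod (ext y j) ^+ 2 = r j ^+ 2.
  move=> jN; rewrite yE // cmodM u1 mulr1 /cmod /= expr0n addr0.
  by rewrite sqr_sqrtr ?sqr_ge0.
have yN : sqnorm N.+1 (fun j => cmod (ext y j)) = sqnorm N.+1 r.
  by apply: eq_bigr => j _; rewrite y2 // -ltnS.
have -> : rform r = support p q (cdot (truncation N.+1 aC bC cC *m y) y).
  rewrite support_truncation_form; congr (_ + _); apply: eq_bigr => j _.
    by rewrite y2 // -ltnS.
  have jN := ltn_ord j.
  have kJ (s : R) : Num.conj (s%:C%C : R[i]) = s%:C%C by exact: conjc_real.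
  rewrite !yE ?(ltnW jN) // conjcM kJ.
  have -> (g s t v w : R[i]) : g * (s * v * (t * w)) = t * s * (g * (v * w)) by ring.
  by rewrite ug -!rmorphM /= mulrC.
have := sqnorm_ge0 N.+1 r; rewrite le_eqVlt => /predU1P[s0|s0].
  have /eqP : cdot y y = 0 by rewrite cdot_cmod yN -s0.
  rewrite cdot_eq0 => /eqP ->; rewrite mulmx0 -s0 mulr0.
  by rewrite /cdot big1 /support ?mulr0 ?addr0 //= => i _; rewrite mxE mul0r.
have s1 : (sqnorm N.+1 r)%:C%C != 0 :> R[i] by rewrite fmorph_eq0 gt_eqF.
pose w := (sqnorm N.+1 r)^-1%:C%C * cdot (truncation N.+1 aC bC cC *m y) y.
have Ww : mx_numerical_range (truncation N.+1 aC bC cC) w.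
  apply: (@mx_numerical_range_Rayleigh _ _ _ y).
    by rewrite -cdot_eq0 cdot_cmod yN.
  by rewrite cdot_cmod yN /w fmorphV mulrC mulrA divff // mul1r.
have := hw _ Ww; rewrite /w supportZ mulrC ler_pdivrMr //.
Qed.

End TruncationSupport.

(** * Convergence and the numerical range on [ell2] *)

Lemma support_le_cmod (R : realType) p q (z : R[i]) :
  `|support p q z| <= (`|p| + `|q|) * cmod z.
Proof.
have Imc : complex.Im z <= cmod z /\ - complex.Im z <= cmod z.
  have := Re_le_cmod ('i%C * z); have := Re_le_cmod (- 'i%C * z).
  rewrite !cmodM; case: z => x y.
  by rewrite /cmod /= !oppr0 !expr0n !add0r sqrrN !expr1n sqrtr1 !mul1r !mul0r
    !sub0r mulNr mul1r opprK => ? ?; split.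
have Rec := Re_le_cmod z; have := Re_le_cmod (- z).
have -> : cmod (- z) = cmod z by apply: complexI; rewrite !cmodE normrN.
have -> : complex.Re (- z) = - complex.Re z by case: z {Imc Rec}.
move=> Rec'; apply: le_trans (ler_normD _ _) _; rewrite !normrM mulrDl.
by apply: lerD; apply: ler_wpM2l; rewrite // ler_norml; lra.
Qed.

Lemma supportB (R : realType) p q (z w : R[i]) :
  support p q (z - w) = support p q z - support p q w.
Proof. by rewrite /support; case: z w => ? ? [? ?] /=; ring. Qed.

Lemma cvg_support (R : realType) (p q : R) (f : nat -> cplx R) (l : cplx R) :
  f @ \oo --> l -> support p q (f n) @[n --> \oo] --> support p q l.
Proof.
move=> fl; apply/cvgrPdist_lt => e e0.
have K0 : 0 < `|p| + `|q| + 1 by rewrite ltr_wpDl ?addr_ge0.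
have e0' : 0 < (e / (`|p| + `|q| + 1))%:C%C :> cplx R by rewrite ltcR divr_gt0.
move/cvgrPdist_lt : fl => /(_ _ e0'); apply: filterS => n.
rewrite -cmodE ltcR ltr_pdivlMr // => lt_e; rewrite -supportB.
apply: le_lt_trans (support_le_cmod _ _ _) _; apply: le_lt_trans lt_e.
by rewrite mulrC ler_wpM2l ?cmod_ge0 // lerDl.
Qed.

Lemma cvg_complex (R : realType) (f : nat -> cplx R) (x y : R) :
  (support 1 0 (f n) @[n --> \oo] --> x) ->
  (support 0 1 (f n) @[n --> \oo] --> y) ->
  f @ \oo --> (Complex x y : cplx R).
Proof.
move=> /cvgrPdist_lt fRe /cvgrPdist_lt fIm; apply/cvgrPdist_lt => e e0.
have eE : e = (complex.Re (e : R[i]))%:C%C by rewrite RRe_real // gtr0_real.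
have e0' : 0 < complex.Re (e : R[i]) / 2 by rewrite divr_gt0 // -ltcR -eE.
near=> n; rewrite eE -cmodE ltcR.
have : `|x - support 1 0 (f n)| < complex.Re (e : R[i]) / 2.
  by near: n; exact: fRe.
have : `|y - support 0 1 (f n)| < complex.Re (e : R[i]) / 2.
  by near: n; exact: fIm.
have := e0'; move: (complex.Re (e : R[i])) => e' e'0.
case: (f n : R[i]) => u v; rewrite /support /cmod /= !mul0r !mul1r addr0 add0r => yl xl.
rewrite -[ltRHS]ger0_norm; last by lra.
rewrite -sqrtr_sqr ltr_sqrt ?exprn_gt0 //; last by lra.
move: xl yl; rewrite !ltr_norml => /andP[? ?] /andP[? ?]; nra.
Unshelve. all: by end_near. Qed.

Lemma cvg_series_zero_tail (C : numClosedFieldType) (F : nat -> C) N :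
  (forall k, (N <= k)%N -> F k = 0) -> series F @ \oo --> \sum_(k < N) F k.
Proof.
move=> F0; apply: cvg_near_cst; exists N => // n /= Nn.
by rewrite /series /= big_mkord -(@sum_ord_zero_tail _ F N n).
Qed.

(** On finitely supported sequences all series are eventually constant, and the quadratic form is
    that of a truncation. *)
Lemma truncation_op_numerical_range (C : numClosedFieldType) N (a b c : nat -> C) :
  mx_numerical_range (truncation N a b c) `<=` op_numerical_range (tridiag_op a b c).
Proof.
move=> _ /mx_numerical_rangeE[y y1 <-]; exists (ext y).
  split.
    apply/cvg_ex; exists (\sum_(k < N) `|ext y k| ^+ 2).
    by apply: cvg_series_zero_tail => k Nk; rewrite ext_ge // normr0 expr0n.
  suff -> : ell2_dot (ext y) (ext y) = 1 by rewrite sqrtC1.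
  rewrite -y1.
  apply/cvg_lim; first exact: norm_hausdorff.
  have -> : cdot y y = \sum_(k < N) ext y k * Num.conj (ext y k).
    by rewrite cdot_ext; apply: eq_bigr => i _; rewrite normCK.
  by apply: cvg_series_zero_tail => k Nk; rewrite ext_ge // mul0r.
rewrite truncation_form; apply/cvg_lim; first exact: norm_hausdorff.
apply: (@cvg_series_zero_tail _
  (fun k => tridiag_op a b c (ext y) k * Num.conj (ext y k))) => k Nk.
by rewrite [ext y k]ext_ge // conjC0 mulr0.
Qed.

(** The support of the sum over the first [n + 1] rows is at most [M] times a partial norm, by the
    bound on chains, plus a boundary term that tends to 0. *)
Lemma op_numerical_range_support_le (R : realType) (p q : R) (a c : nat -> R) (B M : R) :
  (forall k, `|a k| <= B) -> (forall k, `|c k| <= B) ->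
  (forall N r, chain (bond p q a c) N r <= M * sqnorm N.+1 r) ->
  forall w : cplx R, op_numerical_range
      (tridiag_op (fun k => (a k)%:C%C : cplx R) (fun=> 0) (fun k => (c k)%:C%C)) w ->
    support p q w <= M.
Proof.
move=> aB cB hM _ [x [xell x1] <-].
set aC := fun k => (a k)%:C%C; set cC := fun k => (c k)%:C%C.
have B0 : 0 <= B by exact: le_trans (aB 0%N).
pose u k := cmod (x k) ^+ 2.
have u0 k : 0 <= u k by exact: sqr_ge0.
have uE n : series (fun k => `|x k| ^+ 2) n = (series u n)%:C%C :> R[i].
  by rewrite /series /= rmorph_sum; apply: eq_bigr => k _; rewrite -cmod_sqr.
have u_cvg1 : series u n @[n --> \oo] --> (1 : R).
  have lim1 : limn (series (fun k => `|x k| ^+ 2)) = 1 :> cplx R.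
    rewrite -[RHS](expr1n _ 2) -x1 sqrtCK /ell2_dot; congr (limn (series _)).
    by apply/funext => k; rewrite normCK.
  have := @cvg_support _ 1 0 _ _ xell; rewrite [limn _]lim1 /support /= mul1r mul0r addr0.
  rewrite (_ : (fun n => _) = series u) //; apply/funext => n.
  by rewrite uE /= mul1r mul0r addr0.
have u_cvg0 : u n @[n --> \oo] --> (0 : R).
  by apply: cvg_series_cvg_0; apply/cvg_ex; exists 1.
have uS_cvg0 : u n.+1 @[n --> \oo] --> (0 : R) by rewrite cvg_shiftS.
have xx_le j : cmod (x j.+1) * cmod (x j) <= u j + u j.+1.
  rewrite /u; move: (cmod (x j)) (cmod (x j.+1)) => s t.
  by have := sqr_ge0 (t - s); have := sqr_ge0 s; have := sqr_ge0 t; nra.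
pose beta j : R[i] := cC j * x j.+1 * Num.conj (x j) + aC j.+1 * x j * Num.conj (x j.+1).
pose bdry n : R[i] := cC n * x n.+1 * Num.conj (x n).
have SE n : series (fun k => tridiag_op aC (fun=> 0) cC x k * Num.conj (x k)) n.+1 =
    \sum_(j < n) beta j + bdry n.
  rewrite /series /= big_mkord; apply: etrans (tridiag_formE _ _ _ _ _) _.
  by rewrite big1 ?add0r // => j _; rewrite mul0r.
have cmodR (s : R) : cmod (s%:C%C) = `|s|.
  by rewrite /cmod /= expr0n addr0 sqrtr_sqr.
have bdry_le j : cmod (bdry j) <= B * (u j + u j.+1).
  rewrite /bdry !cmodM cmodJ cmodR -mulrA; apply: ler_pM => //.
  by rewrite mulr_ge0 ?cmod_ge0.
have beta_le j s t : `|support s t (beta j)| <= (`|s| + `|t|) * (2 * B) * (u j + u j.+1).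
  rewrite supportD; apply: le_trans (ler_normD _ _) _.
  have h1 := le_trans (support_le_cmod s t (bdry j)) (ler_wpM2l _ (bdry_le j)).
  have h2 : `|support s t (aC j.+1 * x j * Num.conj (x j.+1))| <=
      (`|s| + `|t|) * (B * (u j + u j.+1)).
    apply: le_trans (support_le_cmod _ _ _) _; apply: ler_wpM2l; first exact: addr_ge0.
    rewrite !cmodM cmodJ cmodR -mulrA [cmod (x j) * _]mulrC; apply: ler_pM => //.
    by rewrite mulr_ge0 ?cmod_ge0.
  have := h1 (addr_ge0 (normr_ge0 _) (normr_ge0 _)); rewrite /bdry; lra.
have us_cvg : cvgn (series (fun j => u j + u j.+1)).
  have us2 : cvgn (series (fun j => u j.+1)).
    have := u_cvg1; rewrite -cvg_shiftS => S1.
    apply/cvg_ex; exists (1 - u 0%N).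
    rewrite (_ : series _ = fun n => series u n.+1 - u 0%N).
      by apply: cvgB => //; exact: cvg_cst.
    by apply/funext => n; rewrite /series /= big_nat_recl // addrAC subrr add0r.
  have us1 : cvgn (series u) by apply/cvg_ex; exists 1.
  by rewrite -[X in series X]/(u \+ (fun j => u j.+1)); exact: is_cvg_seriesD.
(* [ell2_dot] is a [limn], so convergence has to be shown: the terms are dominated by a multiple of
   the summable [u j + u j.+1]. *)
have beta_cvg s t : cvgn (series (fun j => support s t (beta j))).
  apply: normed_cvg; apply: (series_le_cvg _ _ (fun j => beta_le j s t)) => //.
    by move=> j; rewrite !mulr_ge0 ?addr_ge0.
  exact: is_cvg_seriesZ.
have bdry_cvg s t : support s t (bdry n) @[n --> \oo] --> (0 : R).
  apply/norm_cvg0P.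
  apply: (@squeeze_cvgr _ _ _ _ (fun=> 0) (fun n => (`|s| + `|t|) * (B * (u n + u n.+1)))).
  - apply: nearW => n; rewrite normr_ge0 /=; apply: le_trans (support_le_cmod _ _ _) _.
    by apply: ler_wpM2l; first exact: addr_ge0.
  - exact: cvg_cst.
  - rewrite -[X in _ --> X](mulr0 (`|s| + `|t|)) -[X in _ * X](mulr0 B) -[X in B * X](addr0 0).
    by apply: cvgMr; apply: cvgMr; exact: cvgD.
have S_cvg s t : support s t (\sum_(j < n) beta j + bdry n) @[n --> \oo] -->
    limn (series (fun j => support s t (beta j))).
  rewrite -[X in _ --> X]addr0.
  rewrite (_ : (fun n => _) = fun n => series (fun j => support s t (beta j)) n +
    support s t (bdry n)); first by apply: cvgD; [exact: beta_cvg|exact: bdry_cvg].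
  by apply/funext => n; rewrite supportD support_sum /series /= big_mkord.
have {S_cvg} := cvg_complex (S_cvg 1 0) (S_cvg 0 1).
set l := (Complex _ _ : cplx R) => S_cvg.
have -> : ell2_dot (tridiag_op aC (fun=> 0) cC x) x = l.
  apply/cvg_lim; first exact: norm_hausdorff.
  rewrite -cvg_shiftS; rewrite (_ : [sequence _]_n = fun n => \sum_(j < n) beta j + bdry n) //.
  by apply/funext => n; exact: SE.
have bound_cvg : M * series u n.+1 + support p q (bdry n) @[n --> \oo] --> M.
  rewrite -[X in _ --> X]addr0; apply: cvgD (bdry_cvg p q).
  by rewrite -[X in _ --> X]mulr1; apply: cvgMr; rewrite cvg_shiftS.
apply: (ler_cvg_to (@cvg_support _ p q _ _ S_cvg) bound_cvg).
apply: nearW => n; rewrite supportD lerD2r support_sum.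
have := hM n (fun j => cmod (x j)); rewrite /series /= big_mkord; apply: le_trans.
apply: ler_sum => j _; rewrite support_bond; apply: le_trans (Re_le_cmod _) _.
by rewrite !cmodM cmodJ [cmod (x j) * _]mulrC.
Qed.

(** * The convex hull as the numerical range of a direct sum *)

Lemma mx_numerical_range_neq0 (C : numClosedFieldType) n (A : 'M[C]_n.+1) :
  mx_numerical_range A !=set0.
Proof.
pose v : 'cV[C]_n.+1 := const_mx 1.
have v0 : v != 0.
  by apply/eqP => /matrixP/(_ 0 0)/eqP; rewrite !mxE oner_eq0.
exists (cdot (A *m v) v / cdot v v).
by apply: (mx_numerical_range_Rayleigh v0); rewrite divfK // cdot_eq0.
Qed.

Lemma cdot_col_mx (C : numClosedFieldType) m n (x x' : 'cV[C]_m) (y y' : 'cV[C]_n) :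
  cdot (col_mx x y) (col_mx x' y') = cdot x x' + cdot y y'.
Proof.
rewrite /cdot big_split_ord; congr (_ + _); apply: eq_bigr => i _.
  by rewrite !col_mxEu.
by rewrite !col_mxEd.
Qed.

Lemma block_mx_form (C : numClosedFieldType) m n (A : 'M[C]_m) (B : 'M[C]_n) x y :
  cdot (block_mx A 0 0 B *m col_mx x y) (col_mx x y) = cdot (A *m x) x + cdot (B *m y) y.
Proof. by rewrite mul_block_col !mul0mx addr0 add0r cdot_col_mx. Qed.

Lemma conv_complexP (R : realType) (t : {i01 cplx R})
    (x y : convex_lmodType (cplx R)^o) :
  exists s : R, [/\ 0 <= s, s <= 1 &
    conv t x y = (1 - s)%:C%C * y + s%:C%C * x :> cplx R].
Proof.
have [t0 t1] : 0 <= (t%:num : R[i]) /\ (t%:num : R[i]) <= 1 by [].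
have tE : (t%:num : R[i]) = (complex.Re (t%:num : R[i]))%:C%C.
  by rewrite RRe_real // ger0_real.
exists (complex.Re (t%:num : R[i])); split; rewrite -?lecR -?tE //.
by rewrite addrC [(1 - _)%:C%C](rmorphB (real_complex R) 1) /= -tE.
Qed.

(** At a unit vector [(x, y)] the form of the direct sum combines the Rayleigh quotients of [x] and
    [y] with weights [|x|^2] and [|y|^2]. The hull thereby inherits convexity, closedness and
    boundedness from a single matrix. *)
Lemma convex_hull_block (R : realType) m n (A : 'M[R[i]]_m) (B : 'M[R[i]]_n) :
  convex_hull (mx_numerical_range A `|` mx_numerical_range B : set (cplx R)) =
  mx_numerical_range (block_mx A 0 0 B).
Proof.
have c0 k : cdot (0 : 'cV[R[i]]_k) 0 = 0 by apply/eqP; rewrite cdot_eq0.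
apply/seteqP; split=> [w hull|w].
  apply: hull; split.
    move=> x y t /set_mem Wx /set_mem Wy; apply: mem_set.
    have [s [s0 s1 ->]] := conv_complexP t x y.
    exact: Toeplitz_Hausdorff.
  move=> v [|] /mx_numerical_rangeE[x x1 <-]; apply/mx_numerical_rangeE.
    exists (col_mx x 0); first by rewrite cdot_col_mx x1 c0 addr0.
    by rewrite block_mx_form mulmx0 c0 addr0.
  exists (col_mx 0 x); first by rewrite cdot_col_mx x1 c0 add0r.
  by rewrite block_mx_form mulmx0 c0 add0r.
move=> /mx_numerical_rangeE[v]; rewrite -(vsubmxK v) cdot_col_mx block_mx_form.
move: (usubmx v) (dsubmx v) => x y xy1 <- H [Hconv HAB].
have WA : x != 0 -> H (cdot (A *m x) x / cdot x x).
  move=> x0; apply: HAB; left; apply: (mx_numerical_range_Rayleigh x0).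
  by rewrite divfK // cdot_eq0.
have WB : y != 0 -> H (cdot (B *m y) y / cdot y y).
  move=> y0; apply: HAB; right; apply: (mx_numerical_range_Rayleigh y0).
  by rewrite divfK // cdot_eq0.
have [x0|x0] := eqVneq x 0.
  move: xy1 WB; rewrite x0 mulmx0 c0 !add0r => y1.
  by rewrite y1 divr1; apply; rewrite -cdot_eq0 y1 oner_eq0.
have [y0|y0] := eqVneq y 0.
  move: xy1 WA; rewrite y0 mulmx0 c0 !addr0 => x1.
  by rewrite x1 divr1; apply.
have x_le1 : cdot x x <= 1 by rewrite -xy1 lerDl cdot_ge0.
have := Hconv _ _ (Itv01 (cdot_ge0 x) x_le1) (mem_set (WA x0)) (mem_set (WB y0)).
move/set_mem; congr H.
have -> : forall u w : R[i], conv (Itv01 (cdot_ge0 x) x_le1) (u : convex_lmodType (cplx R)^o) w =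
    cdot x x * u + (1 - cdot x x) * w by [].
rewrite -xy1 addrAC subrr add0r.
by congr (_ + _); rewrite mulrC divfK // cdot_eq0.
Qed.

(** * The union of the numerical ranges of all truncations *)

(** Vectors are extended by zeros; the nesting is what makes the union convex. *)
Lemma truncation_mono (C : numClosedFieldType) (a b c : nat -> C) m n : (m <= n)%N ->
  mx_numerical_range (truncation m a b c) `<=` mx_numerical_range (truncation n a b c).
Proof.
move=> mn _ /mx_numerical_rangeE[y y1 <-]; apply/mx_numerical_rangeE.
pose z : 'cV[C]_n := \col_i ext y i.
have zE : ext z = ext y.
  by apply: ext_col => k nk; apply: ext_ge; exact: leq_trans nk.
exists z; rewrite ?cdot_ext ?truncation_form zE.
  rewrite -y1 cdot_ext; symmetry.
  apply: (@sum_ord_zero_tail _ (fun k => `|ext y k| ^+ 2)) => // k mk.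
  by rewrite ext_ge // normr0 expr0n.
symmetry; apply: (@sum_ord_zero_tail _
  (fun k => tridiag_op a b c (ext y) k * Num.conj (ext y k))) => // k mk.
by rewrite [ext y k]ext_ge // conjC0 mulr0.
Qed.

Lemma truncations_convex (R : realType) (a b c : nat -> cplx R) x y (t : R) :
  0 <= t -> t <= 1 ->
  (\bigcup_N mx_numerical_range (truncation N.+1 a b c)) x ->
  (\bigcup_N mx_numerical_range (truncation N.+1 a b c)) y ->
  (\bigcup_N mx_numerical_range (truncation N.+1 a b c)) ((1 - t)%:C%C * x + t%:C%C * y).
Proof.
move=> t0 t1 [m _ Wx] [n _ Wy]; exists (maxn m n) => //.
apply: Toeplitz_Hausdorff => //.
  by apply: truncation_mono Wx; rewrite ltnS leq_maxl.
by apply: truncation_mono Wy; rewrite ltnS leq_maxr.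
Qed.

Lemma chain_le_bounded (R : realFieldType) (d : nat -> R) K N r :
  (forall j, 0 <= d j <= K) -> chain d N r <= K * sqnorm N.+1 r.
Proof.
(* The half bond at the last site strengthens the claim for the induction, as AM-GM on the next bond
   costs [K / 2] at each end. *)
move=> dK; suff : chain d N r + K / 2 * r N ^+ 2 <= K * sqnorm N.+1 r.
  have /andP[d0 d1] := dK 0%N; apply: le_trans.
  by rewrite lerDl mulr_ge0 ?sqr_ge0 // divr_ge0 // (le_trans d0).
elim: N => [|N IH].
  rewrite /chain big_ord0 add0r /sqnorm big_ord1 ler_wpM2r ?sqr_ge0 //.
  by have /andP[] := dK 0%N; lra.
rewrite /chain /sqnorm big_ord_recr /= [X in _ <= _ * X]big_ord_recr /=.
move: IH; rewrite -/(chain d N r) -/(sqnorm N.+1 r) mulrDr.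
have /andP[] := dK N; move: (d N) (r N) (r N.+1) => e x y e0 eK IH.
have : e * (x * y) <= K / 2 * (x ^+ 2 + y ^+ 2).
  have := mulr_ge0 e0 (sqr_ge0 (x - y)).
  have : 0 <= (K - e) * (x ^+ 2 + y ^+ 2).
    by rewrite mulr_ge0 ?subr_ge0 ?addr_ge0 ?sqr_ge0.
  by nra.
by lra.
Qed.

Lemma bond_le (R : realType) (p q : R) (a c : nat -> R) (B : R) j :
  (forall k, `|a k| <= B) -> (forall k, `|c k| <= B) ->
  bond p q a c j <= (`|p| + `|q|) * (2 * B).
Proof.
move=> aB cB; set u := p * (c j + a j.+1); set v := q * (a j.+1 - c j).
have : bond p q a c j <= `|u| + `|v|.
  rewrite /bond /cmod /= -/u -/v -[leRHS]ger0_norm ?addr_ge0 // -sqrtr_sqr.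
  rewrite ler_sqrt ?sqr_ge0 // -[u ^+ 2]real_normK ?num_real //.
  rewrite -[v ^+ 2]real_normK ?num_real //.
  by have := mulr_ge0 (normr_ge0 u) (normr_ge0 v); lra.
move=> /le_trans; apply; rewrite /u /v !normrM mulrDl.
have h1 := ler_normD (c j) (a j.+1); have h2 := ler_normB (a j.+1) (c j).
have ha := aB j.+1; have hc := cB j.
by apply: lerD; apply: ler_wpM2l => //; lra.
Qed.

Lemma truncations_bounded (R : realType) (a c : nat -> R) (B : R) :
  (forall k, `|a k| <= B) -> (forall k, `|c k| <= B) ->
  exists K, forall w : cplx R,
    (\bigcup_N mx_numerical_range (truncation N.+1 (fun k => (a k)%:C%C : cplx R)
       (fun=> 0) (fun k => (c k)%:C%C))) w ->
    complex.Re w ^+ 2 + complex.Im w ^+ 2 <= K.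
Proof.
move=> aB cB.
have sup_le p q w : `|p| + `|q| = 1 ->
    (\bigcup_N mx_numerical_range (truncation N.+1 (fun k => (a k)%:C%C : cplx R)
       (fun=> 0) (fun k => (c k)%:C%C))) w -> support p q w <= 2 * B.
  move=> pq1 [N _]; apply: (@support_truncation_le _ p q a (fun=> 0) c) => r.
  rewrite big1 ?add0r; last by move=> i _; rewrite mulr0 mul0r.
  apply: chain_le_bounded => j; rewrite cmod_ge0 /=.
  by have := bond_le p q j aB cB; rewrite pq1 mul1r.
(* The four axis directions confine both components of [w] to [[- 2 B, 2 B]]. *)
exists (2 * (2 * B) ^+ 2) => w Fw.
have := sup_le 1 0 w _ Fw; have := sup_le (-1) 0 w _ Fw.
have := sup_le 0 1 w _ Fw; have := sup_le 0 (-1) w _ Fw.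
rewrite /support !normrN !normr1 !normr0 addr0 add0r !mul0r !addr0 !add0r !mul1r !mulN1r.
move=> /(_ erefl) i1 /(_ erefl) i2 /(_ erefl) r1 /(_ erefl) r2.
have sq z : - z <= 2 * B -> z <= 2 * B -> z ^+ 2 <= (2 * B) ^+ 2.
  by move=> z1 z2; rewrite -subr_ge0 subr_sqr mulr_ge0 //; lra.
by have := sq _ i1 i2; have := sq _ r1 r2; lra.
Qed.

Lemma periodic_bounded (R : realType) n (u : nat -> R) :
  periodic n.+1 u -> exists B, forall k, `|u k| <= B.
Proof.
move=> u_per; exists (\sum_(j < n.+1) `|u j|) => k.
rewrite (divn_eq k n.+1) periodic_mul // (bigD1 (Ordinal (ltn_pmod k (ltn0Sn n)))) //=.
by rewrite lerDl sumr_ge0.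
Qed.

(** * The matrices [A^+] and [A^-] and their supports *)

Definition corner (R : realType) n (e : R) (k : nat) : R :=
  if (k == 0%N) || (k == n) then e else 0.

(** The shift by one makes the inner bonds [d 1, ..., d n], and [c 0 = a 1] makes both corners
    [e * c 0]. *)
Lemma Amx_truncation (R : realType) n (e : R) (a c : nat -> R) : c 0%N = a 1%N ->
  Amx n (e%:C%C : cplx R) (fun k => (a k)%:C%C) (fun k => (c k)%:C%C) =
  truncation n.+1 (fun k => (a k.+1)%:C%C : cplx R)
    (fun k => (corner n (e * c 0%N) k)%:C%C) (fun k => (c k.+1)%:C%C).
Proof.
move=> ca; apply/matrixP => i j; rewrite !mxE /tridiag_entry /corner.
rewrite -[j == i :> 'I_n.+1]val_eqE /=.
case: eqP => [ji|_] //; rewrite ca.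
by case: eqP => [_|_] /=; [|case: eqP => _]; rewrite ?rmorph0 ?rmorphM.
Qed.

Lemma corner_form (R : realType) n (p e : R) (r : nat -> R) : (0 < n)%N ->
  \sum_(j < n.+1) p * corner n e j * r j ^+ 2 = p * e * (r 0%N ^+ 2 + r n ^+ 2).
Proof.
case: n => // n _; rewrite big_ord_recl big_ord_recr /= /corner /=.
rewrite /bump /= !add1n eqxx big1 ?add0r ?mulrDr // => i _.
by rewrite add1n eqSS ltn_eqF // mulr0 mul0r.
Qed.

(** As [c 0 = a 1], the imaginary part cancels: half of [d 0] is the size of what a corner
    contributes in direction [(p, q)]. *)
Lemma bond0 (R : realType) (p q : R) (a c : nat -> R) : c 0%N = a 1%N ->
  bond p q a c 0%N / 2 = `|p * c 0%N|.
Proof.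
move=> ca; rewrite /bond /cmod /= ca subrr mulr0 expr0n addr0 sqrtr_sqr -mulr2n.
by rewrite mulrnAr normrMn [X in X / _]mulr2n; field.
Qed.

(** The corner coefficient [p * e * c 0] is at most [|p * c 0|], which is [d 0 / 2]. *)
Lemma Amx_support_le (R : realType) n (p q M : R) (a c : nat -> R) : (0 < n)%N ->
  c 0%N = a 1%N ->
  (forall r, block_form (bond p q a c) n r <= M * sqnorm n.+1 r) ->
  forall e : R, `|e| = 1 ->
  forall w, mx_numerical_range
    (Amx n (e%:C%C : cplx R) (fun k => (a k)%:C%C) (fun k => (c k)%:C%C)) w ->
  support p q w <= M.
Proof.
move=> n0 ca hM e e1; rewrite Amx_truncation //.
apply: support_truncation_le => r; apply: le_trans (hM r).
rewrite corner_form // /block_form addrC lerD2l bond0 //.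
rewrite ler_wpM2r ?addr_ge0 ?sqr_ge0 //.
by rewrite mulrCA (le_trans (ler_norm _)) // normrM e1 mul1r.
Qed.

Lemma block_form_le (R : realType) n (p q M : R) (a c : nat -> R) : (0 < n)%N ->
  c 0%N = a 1%N ->
  (forall e : R, e = 1 \/ e = -1 ->
    forall w, mx_numerical_range
      (Amx n (e%:C%C : cplx R) (fun k => (a k)%:C%C) (fun k => (c k)%:C%C)) w ->
    support p q w <= M) ->
  forall r, block_form (bond p q a c) n r <= M * sqnorm n.+1 r.
Proof.
move=> n0 ca hM r.
(* The sign of [p * c 0] decides which of the two matrices attains the corner coefficient
   [d 0 / 2]. *)
have [e e1 ee] : exists2 e : R, e = 1 \/ e = -1 & p * (e * c 0%N) = `|p * c 0%N|.
  have [pc|pc] := leP 0 (p * c 0%N); [exists 1|exists (-1)]; auto.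
    by rewrite mul1r ger0_norm.
  by rewrite mulN1r mulrN ltr0_norm.
have := hM e e1; rewrite Amx_truncation // => /rform_le_of_support/(_ r).
by rewrite corner_form // ee addrC /block_form bond0.
Qed.

(** * Symmetries of the bonds; supports of closures and hulls *)

(** The squared bond is [p^2 (c + a)^2 + q^2 (a - c)^2], so it depends on [a] and [c] through these
    two absolute values only. *)
Lemma bond_eq (R : realType) (p q : R) (a c : nat -> R) j k :
  `|c j + a j.+1| = `|c k + a k.+1| -> `|c j - a j.+1| = `|c k - a k.+1| ->
  bond p q a c j = bond p q a c k.
Proof.
move=> /(congr1 (fun x => x ^+ 2)) hp /(congr1 (fun x => x ^+ 2)) hm.
rewrite !real_normK ?num_real // in hp hm.
rewrite /bond /cmod /= !exprMn hp.
by rewrite -[a j.+1 - _]opprB -[a k.+1 - _]opprB !sqrrN hm.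
Qed.

Lemma bond_periodic (R : realType) (p q : R) (a c : nat -> R) n :
  periodic n a -> periodic n c -> periodic n (bond p q a c).
Proof. by move=> a_per c_per k; rewrite /bond -addSn a_per c_per. Qed.

Lemma support_le_closure (R : realType) (p q M : R) (S : set (cplx R)) z :
  (forall w, S w -> support p q w <= M) -> closure S z -> support p q z <= M.
Proof.
move=> SM /closure_complexP clz; rewrite leNgt; apply/negP => zM.
have K0 : 0 < `|p| + `|q| + 1 by rewrite ltr_wpDl ?addr_ge0.
pose e := (support p q z - M) / (`|p| + `|q| + 1).
have e0 : 0 < e by rewrite divr_gt0 ?subr_gt0.
have [w Sw zw] := clz _ (exprn_gt0 2 e0).
have zw_e : cmod (z - w : R[i]) < e.
  rewrite -[ltRHS]ger0_norm ?ltW // -sqrtr_sqr /cmod ltr_sqrt ?exprn_gt0 //.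
  by move: zw; case: (z : R[i]) (w : R[i]) => ? ? [].
have := le_trans (ler_norm _) (support_le_cmod p q (z - w : R[i])).
rewrite supportB; have := SM _ Sw.
have : (`|p| + `|q|) * cmod (z - w : R[i]) <= (`|p| + `|q|) * e.
  by rewrite ler_wpM2l ?addr_ge0 // ltW.
have eK : e * (`|p| + `|q| + 1) = support p q z - M by rewrite /e divfK // gt_eqF.
by lra.
Qed.

Lemma support_le_hull (R : realType) (p q M : R) (S : set (cplx R)) z :
  (forall w, S w -> support p q w <= M) -> convex_hull S z -> support p q z <= M.
Proof.
move=> SM hz; apply: (hz [set w | support p q w <= M]); split => // x y t.
move=> /set_mem /= xM /set_mem /= yM; apply: mem_set => /=.
have [s [s0 s1 ->]] := conv_complexP t x y.
rewrite supportD !supportZ.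
have : s * support p q x <= s * M by exact: ler_wpM2l.
have : (1 - s) * support p q y <= (1 - s) * M by rewrite ler_wpM2l // subr_ge0.
by lra.
Qed.

(** * Equality of the closure and the hull *)

Local Open Scope complex_scope.

Theorem theorem2p3 (R : realType) (n : nat) (a c : nat -> R)
  (n_gt0 : (0 < n)%N)
  (a_per : periodic n.+1 a) (c_per : periodic n.+1 c)
  (h0 : c 0%N = a 1%N)
  (h1p : `|c 1%N + a 2%N| = `|c n + a 0%N|)
  (h1m : `|c 1%N - a 2%N| = `|c n - a 0%N|)
  (hp : forall j : nat, (2 <= j <= n./2)%N ->
     `|c j + a j.+1| = `|c (n - j + 1)%N + a (n - j + 2)%N|)
  (hm : forall j : nat, (2 <= j <= n./2)%N ->
     `|c j - a j.+1| = `|c (n - j + 1)%N - a (n - j + 2)%N|) :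
  let C : numClosedFieldType := R[i] in
  let aC : nat -> C := fun k => (a k)%:C in
  let cC : nat -> C := fun k => (c k)%:C in
  closure (op_numerical_range (tridiag_op aC (fun=> 0) cC)) =
  convex_hull (mx_numerical_range (Amx n 1 aC cC) `|`
               mx_numerical_range (Amx n (-1) aC cC)).
Proof.
move=> C aC cC.
have an : a n.+1 = a 0%N by rewrite -[n.+1]add0n a_per.
have half p q j : (1 <= j)%N -> (j <= n./2)%N ->
    bond p q a c j = bond p q a c (n.+1 - j)%N.
  case: j => [//|[|j]] _ jn; apply: bond_eq.
  - by rewrite subn1 /= an.
  - by rewrite subn1 /= an.
  - have -> : (n.+1 - j.+2 = n - j.+2 + 1)%N by lia.
    by rewrite hp // -addnS.
  - have -> : (n.+1 - j.+2 = n - j.+2 + 1)%N by lia.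
    by rewrite hm // -addnS.
(* The upper half follows by exchanging [j] and [n + 1 - j]; for odd [n] the middle index is its own
   reflection. *)
have pal p q j : (1 <= j <= n)%N -> bond p q a c j = bond p q a c (n.+1 - j)%N.
  move=> /andP[j1 jn]; have [jh|jh] := leqP j n./2; first exact: half.
  have [kh|kh] := leqP (n.+1 - j) n./2.
    by rewrite [RHS]half //; [congr bond|]; lia.
  by congr bond; lia.
have d_per p q := bond_periodic p q a_per c_per.
have d0 p q : 0 <= bond p q a c 0%N by exact: cmod_ge0.
have [Ba aB] := periodic_bounded a_per; have [Bc cB] := periodic_bounded c_per.
pose B := Num.max Ba Bc.
have {}aB k : `|a k| <= B by rewrite le_max aB.
have {}cB k : `|c k| <= B by rewrite le_max cB orbT.
(* [F] holds the values at finitely supported unit vectors. It stands in for the range of the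
   operator because its convexity and boundedness follow from the truncations. *)
pose F : set (cplx R) := \bigcup_N mx_numerical_range (truncation N.+1 aC (fun=> 0) cC).
have F_sub : F `<=` op_numerical_range (tridiag_op aC (fun=> 0) cC).
  by move=> w [N _]; exact: truncation_op_numerical_range.
have A1 : Amx n 1 aC cC = Amx n 1%:C aC cC.
  by apply: (congr1 (fun e : C => Amx n e aC cC)); exact/esym/(rmorph1 (real_complex R)).
have AN1 : Amx n (-1) aC cC = Amx n (-1)%:C aC cC.
  by apply: (congr1 (fun e : C => Amx n e aC cC)); exact/esym/(rmorphN1 (real_complex R)).
apply/seteqP; split=> z.
(* A line separating [z] from the hull gives a bound [M] for both matrices, which passes to blocks,
   then to chains, to the operator and to its closure, hence to [z]. *)
- move=> clz; apply: contrapT; rewrite convex_hull_block => Kz.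
  pose W : set (cplx R) := mx_numerical_range
    (block_mx (Amx n 1 aC cC) 0 0 (Amx n (-1) aC cC)).
  have [BK hBK] : exists B, forall w, W w -> complex.Re w ^+ 2 + complex.Im w ^+ 2 <= B.
    exact: mx_numerical_range_bounded.
  have Wconv x y (t : R) : 0 <= t -> t <= 1 -> W x -> W y ->
      W ((1 - t)%:C * x + t%:C * y) by exact: Toeplitz_Hausdorff.
  have W0 : W !=set0 by exact: mx_numerical_range_neq0.
  have Wz : ~ closure W z by move=> /mx_numerical_range_closed.
  have [p [q [M [WM zM]]]] := separation hBK W0 Wconv Wz.
  have Asub w : (mx_numerical_range (Amx n 1 aC cC) `|`
      mx_numerical_range (Amx n (-1) aC cC)) w -> W w.
    by rewrite /W -convex_hull_block => Aw H [_]; apply.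
  have hA (e : R) : e = 1 \/ e = -1 ->
      forall w, mx_numerical_range (Amx n e%:C aC cC) w -> support p q w <= M.
    by move=> [] -> w Aw; apply/WM/Asub; [left; rewrite A1|right; rewrite AN1].
  have hchain := chain_le_of_block (d_per p q) (d0 p q) (block_form_le n_gt0 h0 hA).
  have := support_le_closure (op_numerical_range_support_le aB cB hchain) clz.
  by rewrite leNgt zM.
(* Conversely, a line separating [z] from [F] gives a bound for all chains; by the palindrome it
   passes to blocks, then to both matrices and to their hull. *)
- move=> Kz; apply: closure_subset F_sub _ _.
  apply: contrapT => Fz.
  have [BF hBF] := truncations_bounded aB cB.
  have F0 : F !=set0.
    have [w Ww] := mx_numerical_range_neq0 (truncation 1 aC (fun=> 0) cC).
    by exists w, 0%N.
  have Fconv x y (t : R) : 0 <= t -> t <= 1 -> F x -> F y ->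
      F ((1 - t)%:C * x + t%:C * y) by exact: truncations_convex.
  have [p [q [M [FM zM]]]] := separation hBF F0 Fconv Fz.
  have hchain N r : chain (bond p q a c) N r <= M * sqnorm N.+1 r.
    have := @rform_le_of_support _ p q a (fun=> 0) c N M _ r.
    rewrite big1 ?add0r => [|i _]; last by rewrite mulr0 mul0r.
    by apply=> w Fw; apply: FM; exists N.
  have hblock := block_le_of_chain (d_per p q) (d0 p q) (pal p q) hchain.
  have hA (e : R) := @Amx_support_le _ n p q M a c n_gt0 h0 hblock e.
  suff : support p q z <= M by rewrite leNgt zM.
  apply: support_le_hull Kz => w [|]; rewrite ?AN1 ?A1; apply: hA.
    by rewrite normr1.
  by rewrite normrN normr1.
Qed.
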